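(* Let $p\ge1$ be an integer and consider the composite minimization problem $F_*=\min_{x\in\mathrm{dom}\,\psi}\{F(x)=f(x)+\psi(x)\}$ with optimal solution $x^*$, where $f$ is convex and $p$ times continuously differentiable on $\mathrm{dom}\,\psi$, with $p$-th derivative Lipschitz continuous on $\mathrm{dom}\,\psi$ with constant $L_p>0$. Let $M\ge pL_p$ and $$\gamma_p(M)=\frac pM\Big(\frac{p!}{p+1}\Big)^{\frac1p}\Big[\frac{M^2-L_p^2}{p^2-1}\Big]^{\frac{p-1}{2p}}$$ (for $p=1$ the last factor is understood as $1$). Let $\{x_i\},\{v_i\},\{a_i\}$ be generated either by the Primal Reduced-Gradient Method or by the Dual Reduced-Gradient Method started at $x_0\in\mathrm{dom}\,\psi$ (both described in the context), with $x_{i+1}=T^p_M(v_i)$ and reduced gradients $V_\psi(x_i)\ne0$ for $1\le i\le t$. Denote $g_t^*=\min_{1\le i\le t}\|V_\psi(x_i)\|_*$, $A_t=\sum_{i=1}^ta_i$ and $\tilde F_t=\frac1{A_t}\sum_{i=1}^ta_iF(x_i)$. Then for all $t\ge1$, $$g_t^*\le\Big[\frac1{\gamma_p(M)}\|x_0-x^*\|\Big]^p\Big(\frac1t\Big)^{\frac p2},$$ $$\tilde F_t-F_*\le\frac{\|x_0-x^*\|^{p+1}}{p+1}\Big(\frac1{\gamma_p(M)}\Big)^p\Big(\frac{p-1}{p+1}\Big)^{\frac{p-1}2}\Big(\frac1t\Big)^{\frac{p+1}2}$$ (with $0^0=1$ for $p=1$). In particular, for $M=pL_p$, $$g_t^*\le\frac{(p+1)L_p}{p!}\|x_0-x^*\|^p\Big(\frac1t\Big)^{\frac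 p2},\qquad \tilde F_t-F_*\le\frac{L_p\|x_0-x^*\|^{p+1}}{p!}\Big(\frac{p-1}{p+1}\Big)^{\frac{p-1}2}\Big(\frac1t\Big)^{\frac{p+1}2}.$$
   Context: $\mathbb{E}$ is a finite-dimensional real vector space with dual $\mathbb{E}^*$; $B:\mathbb{E}\to\mathbb{E}^*$ is a self-adjoint positive definite linear operator, $\|x\|=\langle Bx,x\rangle^{1/2}$, $\|g\|_*=\langle g,B^{-1}g\rangle^{1/2}$; norms of symmetric multilinear forms are induced by $\|\cdot\|$. $\psi$ is a proper closed convex function on $\mathbb{E}$. Tensor step: $\mathcal{T}^f_{v,p}(y)=\sum_{i=0}^p\frac1{i!}D^if(v)[y-v]^i$ and $T_M^p(v)=\arg\min_{y\in\mathrm{dom}\,\psi}\{\mathcal{T}^f_{v,p}(y)+\frac{M}{(p+1)!}\|y-v\|^{p+1}+\psi(y)\}$. For $T=T^p_M(v)$ the reduced gradient is $V_\psi(T)=\nabla f(T)-\nabla\mathcal{T}^f_{v,p}(T)-\frac M{p!}\|T-v\|^{p-1}B(T-v)$. In both methods the stepsize is $a_{i+1}=\langle V_\psi(x_{i+1}),v_i-x_{i+1}\rangle/\|V_\psi(x_{i+1})\|_*^2$, where $V_\psi(x_{i+1})$ is the reduced gradient with $v=v_i$, $T=x_{i+1}$. Primal method: $v_0=x_0$; for $i\ge0$, compute $x_{i+1}=T^p_M(v_i)$ and $v_{i+1}=\arg\min_{x\in\mathrm{dom}\,\psi}\{a_{i+1}\langle V_\psi(x_{i+1}),x-v_i\rangle+\frac12\|x-v_i\|^2\}$.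 Dual method: $\Psi_0(x)=\frac12\|x-x_0\|^2$; for $i\ge0$, compute $v_i=\arg\min_{x\in\mathrm{dom}\,\psi}\Psi_i(x)$, $x_{i+1}=T_M^p(v_i)$, and $\Psi_{i+1}(x)=\Psi_i(x)+a_{i+1}[\langle\nabla f(x_{i+1}),x-x_{i+1}\rangle+\psi(x)]$. All points defined by the auxiliary problems are assumed to exist. *)

(* Defs.v *)
From HB Require Import structures.
From mathcomp Require Import all_boot all_order all_algebra.
From mathcomp Require Import all_classical all_reals all_analysis.

Set Implicit Arguments.
Unset Strict Implicit.
Unset Printing Implicit Defensive.

Import Order.TTheory GRing.Theory Num.Theory.
Local Open Scope classical_set_scope.
Local Open Scope ring_scope.

Definition dual (R : realType) (E : vectType R) : vectType R := 'Hom(E, R^o).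

(* i-linear forms on E, curried: D^(i+1) f(x) is a linear map from E to the
   i-linear forms, and mform E 1 is convertible to dual E. *)
Fixpoint mform (R : realType) (E : vectType R) (i : nat) : vectType R :=
  if i is j.+1 then 'Hom(E, mform E j) else R^o.

(* A[h_1, ..., h_i] *)
Fixpoint mapp (R : realType) (E : vectType R) (i : nat) :
    mform E i -> i.-tuple E -> R :=
  match i return mform E i -> i.-tuple E -> R with
  | 0 => fun A _ => A
  | j.+1 => fun A hs => mapp ((A : 'Hom(E, mform E j)) (thead hs)) (behead_tuple hs)
  end.

(* A[h]^i *)
Definition mdiag (R : realType) (E : vectType R) (i : nat)
    (A : mform E i) (h : E) : R :=
  mapp A (nseq_tuple i h).

Definition msymmetric (R : realType) (E : vectType R) (i : nat)
    (A : mform E i) : Prop :=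
  forall hs ks : i.-tuple E, perm_eq hs ks -> mapp A hs = mapp A ks.

Section EuclideanStructure.
Context {R : realType} {E : vectType R} (B : 'Hom(E, dual E)).

Definition self_adjoint : Prop :=
  forall x y : E, (B x : 'Hom(E, R^o)) y = (B y : 'Hom(E, R^o)) x.

Definition positive_definite : Prop :=
  forall x : E, x != 0 -> 0 < ((B x : 'Hom(E, R^o)) x : R).

Definition pnorm (x : E) : R := Num.sqrt ((B x : 'Hom(E, R^o)) x : R).

Definition dnorm (g : 'Hom(E, R^o)) : R := Num.sqrt (g ((B^-1)%VF g) : R).

Definition mnorm (i : nat) (A : mform E i) : R :=
  sup [set `|mapp A hs| | hs in
        [set hs : i.-tuple E | forall j : 'I_i, pnorm (tnth hs j) <= 1]].

(* G is a Frechet derivative of g at x relative to the set D. *)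
Definition has_derivative (D : set E) (i : nat) (g : E -> mform E i) (x : E)
    (G : 'Hom(E, mform E i)) : Prop :=
  forall e : R, 0 < e -> exists2 d : R, 0 < d &
    forall y : E, D y -> pnorm (y - x) < d ->
      mnorm (g y - g x - G (y - x)) <= e * pnorm (y - x).

Definition continuous_on (D : set E) (i : nat) (g : E -> mform E i) : Prop :=
  forall x : E, D x -> forall e : R, 0 < e -> exists2 d : R, 0 < d &
    forall y : E, D y -> pnorm (y - x) < d -> mnorm (g y - g x) < e.

(* The gradient of an everywhere defined function (junk value 0 where g is not
   differentiable). *)
Definition gradient (g : E -> R) (x : E) : 'Hom(E, R^o) :=
  xget 0 [set G : 'Hom(E, R^o) | @has_derivative setT 0 g x G].

(* f is p times continuously differentiable on D, with D^i f = Df i.  Only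
   values on D matter.  D need not be open, nor even have interior points; in
   the latter case the derivatives are not determined by f and D, so the family
   Df, and in particular its symmetry, is part of the data. *)
Record Cp_on (D : set E) (p : nat) (f : E -> R)
    (Df : forall i : nat, E -> mform E i) : Prop := {
  Cp_on0 : forall x, D x -> Df 0%N x = f x;
  Cp_onS : forall i x, (i < p)%N -> D x -> has_derivative D (Df i) x (Df i.+1 x);
  Cp_on_sym : forall i x, (i <= p)%N -> D x -> msymmetric (Df i x);
  Cp_on_cont : forall i, (i <= p)%N -> continuous_on D (Df i) }.

Definition mform_lipschitz_on (D : set E) (i : nat) (g : E -> mform E i)
    (L : R) : Prop :=
  forall x y : E, D x -> D y -> mnorm (g x - g y) <= L * pnorm (x - y).

Definition effdom (psi : E -> \bar R) : set E := [set x | (psi x < +oo)%E].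

Definition epigraph (psi : E -> \bar R) : set (E * R^o) :=
  [set z | (psi z.1 <= (z.2 : R)%:E)%E].

Definition proper_function (psi : E -> \bar R) : Prop :=
  (forall x, psi x != -oo%E) /\ effdom psi !=set0.

(* The epigraph contains its adherent points. *)
Definition closed_function (psi : E -> \bar R) : Prop :=
  forall (x : E) (r : R),
    (forall e : R, 0 < e -> exists y : E, exists s : R,
       [/\ epigraph psi (y, s), pnorm (y - x) < e & `|s - r| < e]) ->
    epigraph psi (x, r).

Definition closed_convex (psi : E -> \bar R) : Prop :=
  convex_set (epigraph psi) /\ closed_function psi.

Definition is_argmin (D : set E) (g : E -> R) (x : E) : Prop :=
  D x /\ forall y, D y -> g x <= g y.

(* F = f + psi, read on effdom psi only, where psi is finite. *)
Definition objective (f : E -> R) (psi : E -> \bar R) (x : E) : R :=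
  f x + fine (psi x).

Section TensorStep.
Variables (psi : E -> \bar R) (Df : forall i : nat, E -> mform E i).
Variables (p : nat) (M : R).

Definition taylor (v y : E) : R :=
  \sum_(0 <= i < p.+1) (i`!%:R)^-1 * mdiag (Df i v) (y - v).

Definition is_tensor_step (v T : E) : Prop :=
  is_argmin (effdom psi)
    (fun y => taylor v y + M / (p.+1)`!%:R * pnorm (y - v) ^+ p.+1
              + fine (psi y)) T.

Definition reduced_gradient (v T : E) : 'Hom(E, R^o) :=
  (Df 1 T : 'Hom(E, R^o)) - gradient (taylor v) T
  - (M / p`!%:R * pnorm (T - v) ^+ p.-1) *: (B (T - v) : 'Hom(E, R^o)).

Definition stepsize (v T : E) : R :=
  let V := reduced_gradient v T in (V (v - T) : R) / dnorm V ^+ 2.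

(* The first t iterations of the methods. *)

Definition primal_method (x0 : E) (t : nat) (x v : nat -> E) (a : nat -> R)
    : Prop :=
  [/\ x 0%N = x0, v 0%N = x0 &
   forall i, (i < t)%N ->
   [/\ is_tensor_step (v i) (x i.+1),
       a i.+1 = stepsize (v i) (x i.+1) &
       is_argmin (effdom psi)
         (fun y => a i.+1 * (reduced_gradient (v i) (x i.+1) (y - v i) : R)
                   + 2^-1 * pnorm (y - v i) ^+ 2) (v i.+1)]].

Fixpoint dual_model (x0 : E) (x : nat -> E) (a : nat -> R) (i : nat) (y : E)
    : R :=
  if i is j.+1 then
    dual_model x0 x a j y
    + a i * (((Df 1 (x i) : 'Hom(E, R^o)) (y - x i) : R) + fine (psi y))
  else 2^-1 * pnorm (y - x0) ^+ 2.

Definition dual_method (x0 : E) (t : nat) (x v : nat -> E) (a : nat -> R)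
    : Prop :=
  x 0%N = x0 /\
  forall i, (i < t)%N ->
  [/\ is_argmin (effdom psi) (dual_model x0 x a i) (v i),
      is_tensor_step (v i) (x i.+1) &
      a i.+1 = stepsize (v i) (x i.+1)].

End TensorStep.
End EuclideanStructure.

(* The last factor is 1 for p = 1, where the base would be a division by 0. *)
Definition gamma_rate (R : realType) (p : nat) (L M : R) : R :=
  p%:R / M * (p`!%:R / p.+1%:R) `^ (p%:R^-1) *
  (if p == 1%N then 1
   else ((M ^+ 2 - L ^+ 2) / (p%:R ^+ 2 - 1)) `^ ((p%:R - 1) / (2 * p%:R))).

(* Main.v *)
(* Write [d = T - v] and [V] for the reduced gradient of a tensor step [T] from
   [v].  Taylor's theorem along the segment [v, T] says that
   [V + (M / p!) |d|^(p-1) B d] has dual norm at most [(L / p!) |d|^p].  Squaring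
   gives a lower bound for [<V, v - T>] in terms of [|V|] and [|d|], and
   minimizing it over [|d|] by weighted AM-GM gives
   [<V, v - T> >= gamma |V|^((p+1)/p)].
   The optimality condition of the step makes [V] a subgradient of [F] at [T].
   With the stepsize [a = <V, v - T> / |V|^2], both methods then satisfy
   [sum a_i (F x_i - Fstar) + 1/2 sum a_i^2 |V_i|^2 <= 1/2 |x_0 - xstar|^2]:
   the primal one by telescoping [|v_i - xstar|^2], the dual one because the
   models are 1-strongly convex.  Finally [a_i |V_i| >= gamma |V_i|^(1/p)] bounds
   the least gradient, and [a_i >= gamma^p (a_i |V_i|)^(1-p)] together with a
   convexity estimate bounds [A_t] from below. *)

From HB Require Import structures.
Require Import Defs.
From mathcomp Require Import all_boot all_order all_algebra.
From mathcomp Require Import all_classical all_reals all_analysis.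
From mathcomp Require Import ring lra.
Set Implicit Arguments.
Unset Strict Implicit.
Unset Printing Implicit Defensive.
Import Order.TTheory GRing.Theory Num.Theory.
Import numFieldNormedType.Exports.
Local Open Scope classical_set_scope.
Local Open Scope ring_scope.

(** * The Euclidean structure *)

Section InnerProduct.
Context {R : realType} {E : vectType R} {B : 'Hom(E, dual E)}.

Definition inner (x y : E) : R := (B x : 'Hom(E, R^o)) y.

Local Notation "<[ x , y ]>" := (inner x y).
Local Notation N := (pnorm B).

Lemma innerDl x y z : <[x + y, z]> = <[x, z]> + <[y, z]>.
Proof. by rewrite /inner linearD add_lfunE. Qed.

Lemma innerZl a x y : <[a *: x, y]> = a * <[x, y]>.
Proof. by rewrite /inner linearZ scale_lfunE. Qed.

Lemma innerDr x y z : <[x, y + z]> = <[x, y]> + <[x, z]>.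
Proof. by rewrite /inner linearD. Qed.

Lemma innerZr a x y : <[x, a *: y]> = a * <[x, y]>.
Proof. by rewrite /inner linearZ. Qed.

Lemma innerNl x y : <[- x, y]> = - <[x, y]>.
Proof. by rewrite -scaleN1r innerZl mulN1r. Qed.

Lemma innerNr x y : <[x, - y]> = - <[x, y]>.
Proof. by rewrite -scaleN1r innerZr mulN1r. Qed.

Definition innerE := (innerDl, innerDr, innerZl, innerZr, innerNl, innerNr).

Hypotheses (Bs : self_adjoint B) (Bp : positive_definite B).

Lemma innerC x y : <[x, y]> = <[y, x]>.
Proof. exact: Bs. Qed.

Lemma inner_ge0 x : 0 <= <[x, x]>.
Proof.
have [->|x0] := eqVneq x 0; first by rewrite /inner linear0.
exact/ltW/Bp.
Qed.

Lemma sqr_pnorm x : N x ^+ 2 = <[x, x]>.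
Proof. by rewrite sqr_sqrtr ?inner_ge0. Qed.

Lemma pnorm_ge0 x : 0 <= N x.
Proof. exact: sqrtr_ge0. Qed.

Lemma pnorm_gt0 x : x != 0 -> 0 < N x.
Proof. by move=> x0; rewrite sqrtr_gt0; exact: Bp. Qed.

Lemma pnorm0 : N 0 = 0.
Proof. by rewrite /pnorm linear0 sqrtr0. Qed.

Lemma pnormZ a x : N (a *: x) = `|a| * N x.
Proof.
apply/eqP; rewrite -(@eqrXn2 _ 2%N) ?pnorm_ge0 ?mulr_ge0 ?pnorm_ge0//.
by rewrite exprMn real_normK ?num_real// !sqr_pnorm innerZl innerZr mulrA.
Qed.

Lemma pnormN x : N (- x) = N x.
Proof. by rewrite -scaleN1r pnormZ normrN1 mul1r. Qed.

Lemma pnormB x y : N (x - y) = N (y - x).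
Proof. by rewrite -pnormN opprB. Qed.

(** Cauchy-Schwarz: the square of [N y *: x - N x *: y] is [2 * N x * N y * (N x * N y - <[x, y]>)].
    The zero vectors are set apart so that the factor in front is positive. *)
Lemma inner_le_pnorm x y : <[x, y]> <= N x * N y.
Proof.
have [->|x0] := eqVneq x 0.
  by rewrite pnorm0 mul0r /inner linear0 zero_lfunE.
have [->|y0] := eqVneq y 0.
  by rewrite pnorm0 mulr0 /inner linear0.
have := inner_ge0 (N y *: x - N x *: y).
rewrite !innerE (innerC y x) -!sqr_pnorm.
have := pnorm_gt0 x0; have := pnorm_gt0 y0.
move: (N x) (N y) <[x, y]> => a b c b0 a0 h.
have {}h : 0 <= (2 * a * b) * (a * b - c) by nra.
by rewrite -subr_ge0; move: h; rewrite pmulr_rge0// !mulr_gt0.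
Qed.

Lemma norm_inner_le x y : `|<[x, y]>| <= N x * N y.
Proof.
rewrite ler_norml inner_le_pnorm andbT lerNl.
by rewrite -innerNl (le_trans (inner_le_pnorm _ _))// pnormN.
Qed.

Lemma pnormD x y : N (x + y) <= N x + N y.
Proof.
rewrite -(ler_pXn2r (n := 2)) ?nnegrE ?addr_ge0 ?pnorm_ge0//.
rewrite sqrrD !sqr_pnorm !innerE (innerC y x).
have := inner_le_pnorm x y; lra.
Qed.

Lemma lker_metric : lker B == 0%VS.
Proof.
apply/lker0P => x y Bxy; apply/eqP; rewrite -subr_eq0; apply/negPn/negP.
by move=> /Bp; rewrite -/(inner _ _) innerDl innerNl /inner Bxy subrr ltxx.
Qed.

(** Definiteness makes [B] injective, and [E] and its dual have the same dimension, so [B] is onto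
    and its pseudo-inverse is a genuine right inverse. *)
Lemma metric_invK : cancel (B^-1)%VF B.
Proof.
move=> g; apply: limg_lfunVK.
suff -> : limg B = fullv by exact: memvf.
apply/eqP; rewrite eqEdim subvf/= limg_dim_eq; last first.
  by rewrite (eqP lker_metric) capv0.
by rewrite !dimvf; change (dim E * 1 <= dim E)%N; rewrite muln1.
Qed.

(** The Riesz representative: dual norms and pairings become norms and inner products of vectors. *)
Definition riesz (g : 'Hom(E, R^o)) : E := (B^-1)%VF g.

Lemma rieszE (g : 'Hom(E, R^o)) y : g y = <[riesz g, y]>.
Proof. by rewrite /inner /riesz metric_invK. Qed.

Lemma dnormE g : dnorm B g = N (riesz g).
Proof. by rewrite /dnorm /pnorm /riesz metric_invK. Qed.

Lemma dnorm_ge0 g : 0 <= dnorm B g.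
Proof. exact: sqrtr_ge0. Qed.

Lemma dnorm_gt0 g : g != 0 -> 0 < dnorm B g.
Proof.
move=> g0; rewrite dnormE pnorm_gt0//; apply: contra g0 => /eqP h.
by rewrite -[g]metric_invK -/(riesz g) h linear0.
Qed.

Lemma norm_dual_le (g : 'Hom(E, R^o)) y : `|g y : R| <= dnorm B g * N y.
Proof. by rewrite rieszE dnormE norm_inner_le. Qed.

End InnerProduct.

(** * Multilinear forms *)

Section MultilinearAlgebra.
Context {R : realType} {E : vectType R}.

Lemma mappD i (A A' : mform E i) hs : mapp (A + A') hs = mapp A hs + mapp A' hs.
Proof. by elim: i A A' hs => //= i IH A A' hs; rewrite add_lfunE IH. Qed.

Lemma mappZ i c (A : mform E i) hs : mapp (c *: A) hs = c * mapp A hs.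
Proof. by elim: i A hs => //= i IH A hs; rewrite scale_lfunE IH. Qed.

Lemma mapp0 i hs : mapp (0 : mform E i) hs = 0.
Proof. by rewrite -(scale0r (0 : mform E i)) mappZ mul0r. Qed.

Lemma mappB i (A A' : mform E i) hs : mapp (A - A') hs = mapp A hs - mapp A' hs.
Proof. by rewrite mappD -scaleN1r mappZ mulN1r. Qed.

Lemma mapp_sum i (I : Type) (s : seq I) (F : I -> mform E i) hs :
  mapp (\sum_(j <- s) F j) hs = \sum_(j <- s) mapp (F j) hs.
Proof. by apply: (big_morph (fun A => mapp A hs)) => [A A'|]; rewrite ?mappD ?mapp0. Qed.

Lemma mapp_cons i (A : mform E i.+1) h (hs : i.-tuple E) :
  mapp A (cons_tuple h hs) = mapp ((A : 'Hom(E, mform E i)) h) hs.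
Proof. by rewrite /= theadE; congr mapp; apply: val_inj. Qed.

Lemma nseq_tupleS i (h : E) : nseq_tuple i.+1 h = cons_tuple h (nseq_tuple i h).
Proof. exact: val_inj. Qed.

Lemma mdiagS i (A : mform E i.+1) h :
  mdiag A h = mdiag ((A : 'Hom(E, mform E i)) h) h.
Proof. by rewrite /mdiag nseq_tupleS mapp_cons. Qed.

Lemma mapp_scale i (A : mform E i) (c : E -> R) (hs : i.-tuple E) :
  mapp A (map_tuple (fun h => c h *: h) hs) = (\prod_(h <- hs) c h) * mapp A hs.
Proof.
elim: i A hs => [|i IH] A hs; first by rewrite (tuple0 hs) /= big_nil mul1r.
case/tupleP: hs => h hs.
have -> : map_tuple (fun h => c h *: h) [tuple of h :: hs] =
  cons_tuple (c h *: h) (map_tuple (fun h => c h *: h) hs) by exact: val_inj.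
by rewrite !mapp_cons linearZ/= mappZ IH big_cons mulrA.
Qed.

Lemma msymmetric_slice i (A : mform E i.+1) u :
  msymmetric A -> msymmetric ((A : 'Hom(E, mform E i)) u).
Proof. by move=> As hs ks hk; rewrite -!mapp_cons; apply: As; rewrite /= perm_cons. Qed.

(* A[k, u, ..., u] *)
Definition mslice i (A : mform E i.+1) (u k : E) : R^o :=
  mapp A (cons_tuple k (nseq_tuple i u)).

Lemma mslice_linear i (A : mform E i.+1) u : linear (mslice A u).
Proof. by move=> c x y; rewrite /mslice !mapp_cons linearP/= mappD mappZ. Qed.

HB.instance Definition _ i (A : mform E i.+1) u :=
  GRing.isLinear.Build R E R^o _ (mslice A u) (mslice_linear A u).

End MultilinearAlgebra.

(** * Norm bounds and expansions of multilinear forms *)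

Section MultilinearBounds.
Context {R : realType} {E : vectType R} {B : 'Hom(E, dual E)}.
Hypotheses (Bs : self_adjoint B) (Bp : positive_definite B).
Local Notation N := (pnorm B).

(** An explicit constant, unlike the supremum in [mnorm], passes directly to the slices of a
    form. *)
Definition mbounded i (A : mform E i) (C : R) : Prop :=
  0 <= C /\ forall hs, `|mapp A hs| <= C * \prod_(h <- hs) N h.

Lemma prod_pnorm_ge0 (s : seq E) : 0 <= \prod_(h <- s) N h.
Proof. by apply: prodr_ge0 => h _; exact: pnorm_ge0. Qed.

(** Finite dimension enters here: the first argument is expanded in a basis, whose coordinates are
    bounded functionals, and induction bounds the slices. It makes the supremum in [mnorm] one over
    a bounded set. *)
Lemma mbounded_ex i (A : mform E i) : exists C, mbounded A C.
Proof.
elim: i A => [|i IH] A.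
  exists `|A : R|; split=> [|hs]; first exact: normr_ge0.
  by rewrite (tuple0 hs) /= big_nil mulr1.
have [C hC] := choice IH.
pose b := vbasis {:E}.
pose L (j : 'I_(\dim {:E})) : 'Hom(E, R^o) := linfun (coord b j : E -> R^o).
pose Aj (j : 'I_(\dim {:E})) := (A : 'Hom(E, mform E i)) b`_j.
exists (\sum_j dnorm B (L j) * C (Aj j)); split.
  by apply: sumr_ge0 => j _; rewrite mulr_ge0 ?dnorm_ge0//; case: (hC (Aj j)).
move=> hs; case/tupleP: hs => h hs.
rewrite mapp_cons (coord_vbasis (memvf h)) linear_sum mapp_sum /=.
rewrite -(coord_vbasis (memvf h)) big_cons mulr_suml.
apply: le_trans (ler_norm_sum _ _ _) _; apply: ler_sum => j _.
rewrite linearZ mappZ normrM /= mulrACA.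
rewrite ler_pM ?normr_ge0//; last by case: (hC (Aj j)) => _; exact.
have -> : coord b j h = L j h by rewrite lfunE.
exact: (norm_dual_le Bs Bp).
Qed.

Lemma mnorm_ub i (A : mform E i) hs :
  (forall j, N (tnth hs j) <= 1) -> `|mapp A hs| <= mnorm B A.
Proof.
move=> h1; apply: ub_le_sup; last by exists hs.
have [C [C0 hC]] := mbounded_ex A; exists C => _ [ks k1 <-].
rewrite (le_trans (hC ks))// -[leRHS]mulr1 ler_wpM2l// big_tuple.
by apply: prodr_ile1 => j _; rewrite pnorm_ge0 k1.
Qed.

Lemma mnorm_mbounded i (A : mform E i) : mbounded A (mnorm B A).
Proof.
split.
  apply: le_trans (normr_ge0 _) (@mnorm_ub _ A [tuple of nseq i 0] _) => j.
  by rewrite tnth_nseq pnorm0.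
move=> hs; have [C [C0 hC]] := mbounded_ex A.
(* Arguments of norm zero cannot be normalized; there any bound [C] already forces the value to be
   zero. *)
have [P0|P0] := eqVneq (\prod_(h <- hs) N h) 0.
  by have := hC hs; rewrite P0 !mulr0.
have Pp : 0 < \prod_(h <- hs) N h by rewrite lt_def P0 prod_pnorm_ge0.
rewrite -ler_pdivrMr//.
have -> : `|mapp A hs| / \prod_(h <- hs) N h =
    `|mapp A (map_tuple (fun h => (N h)^-1 *: h) hs)|.
  rewrite mapp_scale prodfV normrM mulrC ger0_norm// invr_ge0.
  exact: prod_pnorm_ge0.
apply: mnorm_ub => j; rewrite tnth_map (pnormZ Bp) ger0_norm ?invr_ge0 ?pnorm_ge0//.
have [->|z0] := eqVneq (N (tnth hs j)) 0; first by rewrite mulr0.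
by rewrite mulVf.
Qed.

Lemma mapp_le_mnorm i (A : mform E i) hs :
  `|mapp A hs| <= mnorm B A * \prod_(h <- hs) N h.
Proof. by case: (mnorm_mbounded A) => _; exact. Qed.

Lemma mnorm0E (a : mform E 0) : mnorm B a = `|a : R|.
Proof.
rewrite /mnorm; have -> : [set `|mapp a hs| | hs in
    [set hs : 0.-tuple E | forall j : 'I_0, N (tnth hs j) <= 1]] = [set `|a : R|].
  apply/seteqP; split=> [_ [hs _ <-]//|_ ->]; exists [tuple] => // j.
  by case: j.
exact: sup1.
Qed.

Lemma mbounded_slice i (A : mform E i.+1) C u :
  mbounded A C -> mbounded ((A : 'Hom(E, mform E i)) u) (C * N u).
Proof.
move=> [C0 hC]; split=> [|hs]; first by rewrite mulr_ge0 ?pnorm_ge0.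
by rewrite -mapp_cons (le_trans (hC _))// big_cons mulrA.
Qed.

Lemma mbounded_mdiag i (A : mform E i) C u : mbounded A C ->
  `|mdiag A u| <= C * N u ^+ i.
Proof.
move=> [_ hC]; rewrite (le_trans (hC _))//= big_nseq.
by rewrite iter_mulr_1.
Qed.

(** Peel off the first argument: the slice at [u] changes by the induction hypothesis, and the slice
    at [k] is already of order [N k]. The constant depends only on the degree and the radius. *)
Lemma mdiag_lipschitz i (rho : R) : 0 <= rho -> exists2 c, 0 <= c &
  forall (A : mform E i) C u k, mbounded A C -> N u <= rho -> N k <= rho ->
    `|mdiag A (u + k) - mdiag A u| <= C * c * N k.
Proof.
move=> rho0; elim: i => [|i [c c0 IH]].
  by exists 0 => // A C u k _ _ _; rewrite /mdiag/= subrr normr0 mulr0 mul0r.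
exists (rho * c + (rho + rho) ^+ i).
  by rewrite addr_ge0 ?mulr_ge0 ?exprn_ge0 ?addr_ge0.
move=> A C u k bA hu hk.
rewrite !mdiagS linearD/= {1}/mdiag mappD -!/(mdiag _ _).
set Au := (A : 'Hom(E, mform E i)) u; set Ak := (A : 'Hom(E, mform E i)) k.
have -> : mdiag Au (u + k) + mdiag Ak (u + k) - mdiag Au u =
  (mdiag Au (u + k) - mdiag Au u) + mdiag Ak (u + k) by ring.
apply: le_trans (ler_normD _ _) _.
have h1 := IH _ _ u k (mbounded_slice u bA) hu hk.
have h2 := mbounded_mdiag (u + k) (mbounded_slice k bA).
have C0 : 0 <= C by case: bA.
apply: le_trans (lerD h1 h2) _.
have h3 : N (u + k) ^+ i <= (rho + rho) ^+ i.
  rewrite lerXn2r ?nnegrE ?pnorm_ge0 ?addr_ge0//.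
  by rewrite (le_trans (pnormD Bs Bp _ _))// lerD.
have h4 : C * N u * c * N k <= C * rho * c * N k.
  by rewrite !ler_wpM2r ?pnorm_ge0// ler_wpM2l.
have h5 : C * N k * N (u + k) ^+ i <= C * N k * (rho + rho) ^+ i.
  by rewrite ler_wpM2l ?mulr_ge0 ?pnorm_ge0.
apply: le_trans (lerD h4 h5) _.
by rewrite le_eqVlt; apply/orP; left; apply/eqP; ring.
Qed.

Lemma mslice_sym i (A : mform E i.+2) u k : msymmetric A ->
  mslice ((A : 'Hom(E, mform E i.+1)) u) u k = mslice A u k.
Proof.
move=> As; rewrite /mslice -mapp_cons; apply: As.
by rewrite /= (perm_catCA [:: u] [:: k] (nseq i u)).
Qed.

(* The constant is uniform in [A], as the induction on [i] replaces [A] by its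
   slices. *)
Lemma mdiag_expansion i (rho : R) : 0 <= rho -> exists2 c, 0 <= c &
  forall (A : mform E i.+1) C u k, msymmetric A -> mbounded A C ->
    N u <= rho -> N k <= rho ->
    `|mdiag A (u + k) - mdiag A u - i.+1%:R * mslice A u k| <= C * c * N k ^+ 2.
Proof.
move=> rho0; elim: i => [|i [c c0 IH]].
  exists 0 => // A C u k _ _ _ _; rewrite mulr0 mul0r mul1r.
  rewrite !mdiagS linearD/= /mslice mapp_cons /mdiag/=.
  by rewrite -addrA -opprD subrr normr0.
have [l l0 hl] := @mdiag_lipschitz i.+1 rho rho0.
exists (rho * c + l) => [|A C u k As bA hu hk].
  by rewrite addr_ge0 ?mulr_ge0.
have C0 : 0 <= C by case: bA.
have h1 := IH _ _ u k (msymmetric_slice u As) (mbounded_slice u bA) hu hk.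
have h2 := hl _ _ u k (mbounded_slice k bA) hu hk.
rewrite mslice_sym// in h1.
rewrite (mdiagS A (u + k)) (mdiagS A u) linearD/= {1}/mdiag mappD -!/(mdiag _ _).
have -> : mslice A u k = mdiag ((A : 'Hom(E, mform E i.+1)) k) u.
  by rewrite /mslice mapp_cons.
have E1 : mslice A u k = mdiag ((A : 'Hom(E, mform E i.+1)) k) u.
  by rewrite /mslice mapp_cons.
rewrite E1 in h1.
move: h1 h2.
set Au := (A : 'Hom(E, mform E i.+1)) u; set Ak := (A : 'Hom(E, mform E i.+1)) k.
move=> h1 h2.
(* The slice at [u] accounts for [i.+1] of the linear terms. The last one is subtracted from the
   slice at [k], leaving an increment of order [N k ^+ 2]. *)
have -> : mdiag Au (u + k) + mdiag Ak (u + k) - mdiag Au u - i.+2%:R * mdiag Ak u =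
  (mdiag Au (u + k) - mdiag Au u - i.+1%:R * mdiag Ak u)
  + (mdiag Ak (u + k) - mdiag Ak u).
  by rewrite -[i.+2]add1n natrD; ring.
apply: le_trans (ler_normD _ _) _; apply: le_trans (lerD h1 h2) _.
have h4 : C * N u * c * N k ^+ 2 <= C * rho * c * N k ^+ 2.
  by rewrite !ler_wpM2r ?exprn_ge0 ?pnorm_ge0// ler_wpM2l.
apply: le_trans (lerD h4 (lexx _)) _.
by rewrite le_eqVlt; apply/orP; left; apply/eqP; ring.
Qed.

End MultilinearBounds.

(** * Taylor expansions *)

Section ScalarTaylor.
Context {R : realType}.
Implicit Types (q dq h : R -> R).

(* Relative to [0, 1]: the derivatives of [f] are only relative to [effdom psi],
   so nothing is known beyond the end points of a segment. *)
Definition derive_on_unit q dq : Prop :=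
  forall s, 0 <= s <= 1 -> forall e, 0 < e -> exists2 d, 0 < d &
    forall r, 0 <= r <= 1 -> `|r - s| < d ->
      `|q r - q s - dq s * (r - s)| <= e * `|r - s|.

Lemma derive_on_unitD q1 dq1 q2 dq2 :
  derive_on_unit q1 dq1 -> derive_on_unit q2 dq2 ->
  derive_on_unit (fun s => q1 s + q2 s) (fun s => dq1 s + dq2 s).
Proof.
move=> h1 h2 s s01 e e0.
have e20 : 0 < e / 2 by rewrite divr_gt0.
have [d1 d10 k1] := h1 s s01 _ e20; have [d2 d20 k2] := h2 s s01 _ e20.
exists (Num.min d1 d2) => [|r r01]; first by rewrite lt_min d10.
rewrite lt_min => /andP[r1 r2].
have := k1 r r01 r1; have := k2 r r01 r2.
rewrite [X in _ -> _ -> `|X| <= _](_ : _ = (q1 r - q1 s - dq1 s * (r - s)) +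
  (q2 r - q2 s - dq2 s * (r - s))); last by ring.
have := ler_normD (q1 r - q1 s - dq1 s * (r - s)) (q2 r - q2 s - dq2 s * (r - s)).
lra.
Qed.

Lemma derive_on_unitZ c q dq :
  derive_on_unit q dq -> derive_on_unit (fun s => c * q s) (fun s => c * dq s).
Proof.
move=> hq s s01 e e0.
have c0 : 0 < `|c| + 1 by rewrite ltr_wpDl.
have [d d0 k] := hq s s01 _ (divr_gt0 e0 c0).
exists d => // r r01 rs; have := k r r01 rs.
have -> : c * q r - c * q s - c * dq s * (r - s) = c * (q r - q s - dq s * (r - s)).
  by ring.
rewrite normrM mulrAC ler_pdivlMr// => h; apply: le_trans h.
by rewrite mulrC ler_wpM2l// lerDl.
Qed.

Lemma derive_on_unit_quadratic q dq C : 0 <= C ->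
  (forall r s, 0 <= r <= 1 -> 0 <= s <= 1 ->
    `|q r - q s - dq s * (r - s)| <= C * (r - s) ^+ 2) ->
  derive_on_unit q dq.
Proof.
move=> C0 hq s s01 e e0; have C1 : 0 < C + 1 by rewrite ltr_wpDl.
exists (e / (C + 1)) => [|r r01]; first by rewrite divr_gt0.
rewrite ltr_pdivlMr// => rs; apply: le_trans (hq _ _ r01 s01) _.
rewrite -real_normK ?num_real// expr2 mulrA ler_wpM2r//.
have := normr_ge0 (r - s); move: rs; lra.
Qed.

Lemma derive_on_unit_expn n :
  derive_on_unit (fun s => s ^+ n.+1) (fun s => n.+1%:R * s ^+ n).
Proof.
(* A quadratic remainder uniform on the unit interval survives the induction, since multiplying it
   by [r <= 1] does not enlarge it. *)
suff [C C0 hC] : exists2 C, 0 <= C & forall r s : R, 0 <= r <= 1 -> 0 <= s <= 1 ->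
    `|r ^+ n.+1 - s ^+ n.+1 - n.+1%:R * s ^+ n * (r - s)| <= C * (r - s) ^+ 2.
  exact: derive_on_unit_quadratic C0 hC.
elim: n => [|n [C C0 IH]].
  exists 0 => // r s _ _; rewrite !expr1 expr0 mul0r.
  by rewrite (_ : _ - _ = 0) ?normr0//; ring.
exists (C + n.+1%:R) => [|r s r01 s01]; first by rewrite addr_ge0.
have -> : r ^+ n.+2 - s ^+ n.+2 - n.+2%:R * s ^+ n.+1 * (r - s) =
   r * (r ^+ n.+1 - s ^+ n.+1 - n.+1%:R * s ^+ n * (r - s))
   + n.+1%:R * s ^+ n * (r - s) ^+ 2.
  by rewrite -[n.+2%:R]natr1 !exprS; ring.
apply: le_trans (ler_normD _ _) _; rewrite mulrDl lerD//.
  rewrite normrM; case/andP: r01 => r0 r1.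
  rewrite -[leRHS]mul1r ler_pM//; first by rewrite ger0_norm.
  by apply: IH => //; rewrite r0.
case/andP: s01 => s0 s1.
rewrite normrM (ger0_norm (sqr_ge0 _)) ler_wpM2r ?sqr_ge0// normrM normr_nat.
by rewrite -[leRHS]mulr1 ler_wpM2l// normrX exprn_ile1// ger0_norm.
Qed.

Lemma derive_on_unit_cst c : derive_on_unit (fun=> c) (fun=> 0).
Proof.
apply: (@derive_on_unit_quadratic _ _ 0) => // r s _ _.
by rewrite subrr mul0r subr0 normr0 mul0r.
Qed.

(** Mean value inequality. For each slope [-e], take the supremum [c] of the points of [[0, b]]
    where [h] lies above the line of that slope through [(0, h 0)]; the derivative at [c] puts [c]
    among them and excludes [c < b]. *)
Lemma derive_on_unit_ge0 h l : derive_on_unit h l ->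
  (forall s, 0 <= s <= 1 -> 0 <= l s) -> forall b, 0 <= b <= 1 -> h 0 <= h b.
Proof.
move=> hl l0 b /andP[b0 b1]; apply/ler_addgt0Pr => e e0.
pose S := [set s | 0 <= s <= b /\ h 0 - e * s <= h s].
have S0 : S 0 by rewrite /S /= lexx b0 mulr0 subr0.
have Sb : has_sup S.
  by split; [exists 0 | exists b => s [/andP[]]].
set c := sup S.
have c0 : 0 <= c by apply: ub_le_sup => //; case: Sb.
have cb : c <= b by apply: ge_sup; [exists 0 | move=> s [/andP[]]].
have c01 : 0 <= c <= 1 by rewrite c0 (le_trans cb).
have [d d0 hd] := hl c c01 e e0.
have Sc : S c.
  have [s [/andP[s0 sb] hs] sd] := sup_adherent d0 Sb.
  have sc : s <= c by apply: ub_le_sup; [case: Sb | split=> //; rewrite s0].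
  split; first by rewrite c0.
  have s01 : 0 <= s <= 1 by rewrite s0 (le_trans sb).
  have := hd s s01; rewrite distrC ger0_norm ?subr_ge0//.
  have -> : (c - s < d) by move: sd; rewrite -/c; lra.
  move=> /(_ isT); rewrite ler_norml => /andP[_].
  have : 0 <= l c * (c - s) by rewrite mulr_ge0 ?l0// subr_ge0.
  lra.
have [cb'|bc] := ltP c b; last first.
  have -> : b = c by apply/le_anti; rewrite bc cb.
  case: Sc => _; have : e * c <= e * 1 by rewrite ler_pM2l//; case/andP: c01.
  lra.
(* A point beyond [c], within reach of the derivative estimate at [c], that would still belong to
   [S]. *)
pose r := Num.min b (c + d / 2).
have cr : c < r by rewrite lt_min cb'/= ltrDl divr_gt0.
have rb : r <= b by rewrite ge_min lexx.
have rd : r - c < d.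
  have : r <= c + d / 2 by rewrite ge_min lexx orbT.
  move: d0; lra.
have Sr : S r.
  have r0 : 0 <= r by rewrite (le_trans c0)// ltW.
  split; first by rewrite r0.
  have r01 : 0 <= r <= 1 by rewrite r0 (le_trans rb).
  have := hd r r01; rewrite [`|r - c|]ger0_norm; last by rewrite subr_ge0 ltW.
  move=> /(_ rd); rewrite ler_norml => /andP[+ _].
  have : 0 <= l c * (r - c) by rewrite mulr_ge0 ?l0// subr_ge0 ltW.
  case: Sc => _; lra.
have : r <= c by apply: ub_le_sup => //; case: Sb.
by rewrite leNgt cr.
Qed.

(** Induction on the order: the bound for the shifted family [q j.+1] is integrated by means of
    [derive_on_unit_ge0]. *)
Lemma scalar_taylor n (q : nat -> R -> R) K :
  (forall j, (j < n)%N -> derive_on_unit (q j) (q j.+1)) ->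
  (forall s, 0 <= s <= 1 -> q n s - q n 0 <= K * s) ->
  forall s, 0 <= s <= 1 ->
    q 0%N s - \sum_(0 <= j < n.+1) (j`!%:R)^-1 * s ^+ j * q j 0 <=
    K * s ^+ n.+1 / n.+1`!%:R.
Proof.
elim: n q => [|n IH] q qd qK s s01.
  have f1 : (1`!%:R : R) = 1 by [].
  by rewrite big_nat1 !f1 invr1 expr0 !mul1r mulr1 expr1; exact: qK.
pose P m s := \sum_(0 <= j < m) (j`!%:R)^-1 * s ^+ j * q j 0.
pose P' m s := \sum_(0 <= j < m) (j`!%:R)^-1 * s ^+ j * q j.+1 0.
have factS m : (m.+1`!%:R : R)^-1 * m.+1%:R = m`!%:R^-1.
  by rewrite factS natrM invfM mulrAC mulVf ?mul1r// pnatr_eq0.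
have Pd m : derive_on_unit (P m.+1) (P' m).
  elim: m => [|m IHm].
    rewrite (_ : P 1%N = fun=> q 0%N 0); last first.
      by apply/funext => r; rewrite /P big_nat1 fact0 invr1 expr0 !mul1r.
    rewrite (_ : P' 0%N = fun=> 0); first exact: derive_on_unit_cst.
    by apply/funext => r; rewrite /P' big_geq.
  have := derive_on_unitD IHm (derive_on_unitZ ((m.+1`!%:R)^-1 * q m.+1 0)
    (derive_on_unit_expn m)).
  rewrite [X in derive_on_unit X](_ : _ = P m.+2); last first.
    by apply/funext => r; rewrite /P [in RHS]big_nat_recr//=; congr (_ + _); ring.
  rewrite [X in derive_on_unit _ X](_ : _ = P' m.+1)//.
  apply/funext => r; rewrite /P' [in RHS]big_nat_recr//=; congr (_ + _).
  by rewrite -(factS m); ring.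
(* The claimed bound minus the remainder: it vanishes at 0, and its derivative is nonnegative by the
   induction hypothesis. *)
have := derive_on_unitD (derive_on_unitD (derive_on_unitZ (K / n.+2`!%:R)
  (derive_on_unit_expn n.+1)) (derive_on_unitZ (-1) (qd 0%N isT))) (Pd n.+1).
move=> /derive_on_unit_ge0 /(_ _ s s01).
rewrite expr0n/= mulr0 add0r.
have -> : P n.+2 0 = q 0%N 0.
  rewrite /P big_nat_recl//= fact0 invr1 expr0 !mul1r big1_seq ?addr0// => j _.
  by rewrite expr0n/= mulr0 mul0r.
rewrite mulN1r addNr => H.
have {}H : 0 <= K / n.+2`!%:R * s ^+ n.+2 + -1 * q 0%N s + P n.+2 s.
  apply: H => r r01.
  have := IH (fun j => q j.+1) (fun j jn => qd j.+1 jn) qK r r01.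
  rewrite -/(P' n.+1 r) -(factS n.+1) => h.
  have -> : K / n.+2`!%:R * (n.+2%:R * r ^+ n.+1) =
    K * r ^+ n.+1 * (n.+2`!%:R^-1 * n.+2%:R) by ring.
  move: h; lra.
rewrite -/(P n.+2 s) mulrAC; move: H; lra.
Qed.

End ScalarTaylor.

(** * The gradient of the Taylor polynomial *)

Section TaylorGradient.
Context {R : realType} {E : vectType R} {B : 'Hom(E, dual E)}.
Hypotheses (Bs : self_adjoint B) (Bp : positive_definite B).
Local Notation N := (pnorm B).

(** Two derivatives are compared along a short multiple of a vector [h] where they differ; this
    makes the value picked by [gradient] determinate. *)
Lemma has_derivative_unique (g : E -> R) x (G G' : 'Hom(E, R^o)) :
  @has_derivative _ _ B setT 0 g x G -> @has_derivative _ _ B setT 0 g x G' ->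
  G = G'.
Proof.
move=> hG hG'; apply/lfunP => h; apply/eqP; rewrite -subr_eq0; apply/negPn/negP => GG.
set c := `|(G h - G' h : R)|.
have c0 : 0 < c by rewrite normr_gt0.
have h0 : 0 < N h.
  rewrite pnorm_gt0//; apply: contraNneq GG => ->.
  by rewrite !linear0 ?subrr ?addr0.
(* With this precision the two errors along [s *: h] add up to [s * c / 2], although the derivatives
   differ there by [s * c]. *)
have e0 : 0 < c / (4 * N h) by rewrite divr_gt0// mulr_gt0.
have [d d0 k] := hG _ e0; have [d' d'0 k'] := hG' _ e0.
pose s := Num.min d d' / (2 * N h).
have m0 : 0 < Num.min d d' by rewrite lt_min d0.
have s0 : 0 < s by rewrite divr_gt0// mulr_gt0.
have Ns : N (s *: h) = s * N h by rewrite pnormZ// ger0_norm// ltW.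
have sm : s * N h < Num.min d d'.
  have -> : s * N h = Num.min d d' / 2 by rewrite /s; field; rewrite gt_eqF.
  by move: m0; lra.
move: sm; rewrite lt_min -Ns => /andP[sd sd'].
have hx : x + s *: h - x = s *: h by rewrite addrC addKr.
have := k (x + s *: h) I; have := k' (x + s *: h) I.
have Gs (g' : 'Hom(E, R^o)) : (g' (s *: h) : R) = s * (g' h : R) by rewrite linearZ.
rewrite hx !(mnorm0E (B := B)) => /(_ sd') H' /(_ sd) H.
rewrite Ns Gs in H; rewrite Ns Gs in H'.
have Hc : s * c <= 2 * (c / (4 * N h) * (s * N h)).
  have -> : s * c = `|s * (G h - G' h : R)| by rewrite normrM (ger0_norm (ltW s0)).
  set u := (g (x + s *: h) - g x : R).
  have -> : s * (G h - G' h) = (u - s * G' h) - (u - s * G h) by ring.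
  apply: le_trans (ler_normB _ _) _.
  move: H H'; rewrite -/u; lra.
have : 2 * (c / (4 * N h) * (s * N h)) = s * c / 2 by field; rewrite gt_eqF.
have : 0 < s * c by rewrite mulr_gt0.
move: Hc; lra.
Qed.

Lemma gradient_eq (g : E -> R) x (G : 'Hom(E, R^o)) :
  @has_derivative _ _ B setT 0 g x G -> gradient B g x = G.
Proof.
move=> hG; apply: xget_subset1 => // G1 G2 h1 h2.
exact: has_derivative_unique h1 h2.
Qed.

Variables (p : nat) (Df : forall i, E -> mform E i) (v : E).
Hypothesis Dfs : forall i, (i <= p)%N -> msymmetric (Df i v).

(** By symmetry the term of degree [i.+1] differentiates to [i.+1] equal slices, which turns its
    coefficient into the inverse of [i] factorial. *)
Definition taylor_gradient (T : E) : 'Hom(E, R^o) :=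
  \sum_(0 <= i < p) (i`!%:R)^-1 *: linfun (mslice (Df i.+1 v) (T - v)).

Lemma taylor_gradientE T h : (taylor_gradient T h : R) =
  \sum_(0 <= i < p) (i`!%:R)^-1 * mslice (Df i.+1 v) (T - v) h.
Proof.
rewrite /taylor_gradient sum_lfunE; apply: eq_bigr => i _.
by rewrite scale_lfunE lfunE.
Qed.

Lemma taylor_expansion T : exists2 K, 0 <= K & forall k, N k <= 1 ->
  `|taylor Df p v (T + k) - taylor Df p v T - (taylor_gradient T k : R)|
    <= K * N k ^+ 2.
Proof.
(* The remainder is regrouped degree by degree, the constant term cancelling, so that
   [mdiag_expansion] applies to each summand. *)
suff [K K0 hK] : exists2 K, 0 <= K & forall k, N k <= 1 ->
    `|\sum_(0 <= i < p) ((i.+1`!%:R)^-1 * (mdiag (Df i.+1 v) (T - v + k)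
        - mdiag (Df i.+1 v) (T - v) - i.+1%:R * mslice (Df i.+1 v) (T - v) k))|
    <= K * N k ^+ 2.
  exists K => // k k1; have := hK k k1; congr (`|_| <= _).
  have md0 h : mdiag (Df 0%N v) h = Df 0%N v by [].
  rewrite taylor_gradientE /taylor ![in RHS]big_nat_recl// !md0.
  rewrite opprD addrACA subrr add0r -!sumrB.
  apply: eq_bigr => i _; rewrite (addrAC T k) !mulrBr; congr (_ - _).
  rewrite mulrA; congr (_ * _).
  by rewrite factS natrM invfM mulrAC mulVf ?mul1r// pnatr_eq0.
have rho0 : 0 <= N (T - v) + 1 by rewrite addr_ge0 ?pnorm_ge0.
suff H n : (n <= p)%N -> exists2 K, 0 <= K & forall k, N k <= 1 ->
    `|\sum_(0 <= i < n) ((i.+1`!%:R)^-1 * (mdiag (Df i.+1 v) (T - v + k)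
        - mdiag (Df i.+1 v) (T - v) - i.+1%:R * mslice (Df i.+1 v) (T - v) k))|
    <= K * N k ^+ 2 by exact: H.
elim: n => [|n IH] np.
  by exists 0 => // k _; rewrite big_geq// normr0 mul0r.
have [K K0 hK] := IH (ltnW np).
have [c c0 hc] := mdiag_expansion Bs Bp n rho0.
have [C [C0 hC]] := mbounded_ex Bs Bp (Df n.+1 v).
exists (K + (n.+1`!%:R)^-1 * (C * c)) => [|k k1].
  by rewrite addr_ge0// !mulr_ge0.
rewrite big_nat_recr//=; apply: le_trans (ler_normD _ _) _.
rewrite mulrDl lerD ?hK// normrM ger0_norm// -mulrA ler_wpM2l//.
apply: hc => //; first exact: Dfs.
- by rewrite lerDl.
- by rewrite (le_trans k1)// lerDr pnorm_ge0.
Qed.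

Lemma gradient_taylor T : gradient B (taylor Df p v) T = taylor_gradient T.
Proof.
apply: gradient_eq => e e0.
have [K K0 hK] := taylor_expansion T; have K1 : 0 < K + 1 by rewrite ltr_wpDl.
exists (Num.min 1 (e / (K + 1))) => [|y _]; first by rewrite lt_min ltr01 divr_gt0.
rewrite lt_min ltr_pdivlMr// => /andP[/ltW k1 ke].
rewrite (mnorm0E (B := B)); have := hK (y - T) k1; rewrite [T + _]addrC subrK.
move/le_trans; apply; rewrite expr2 mulrA ler_wpM2r ?pnorm_ge0//.
have := pnorm_ge0 (B := B) (y - T); move: ke; lra.
Qed.

End TaylorGradient.

(** * Convexity *)

Section ConvexPowers.
Context {R : realType} {E : vectType R} {B : 'Hom(E, dual E)}.
Hypotheses (Bs : self_adjoint B) (Bp : positive_definite B).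
Local Notation N := (pnorm B).
Local Notation "<[ x , y ]>" := (inner (B := B) x y).

Lemma expr_convex n (a b : R) : 0 <= a -> 0 <= b ->
  b ^+ n.+1 - a ^+ n.+1 <= n.+1%:R * b ^+ n * (b - a).
Proof.
move=> a0 b0; elim: n => [|n IH]; first by rewrite !expr1 expr0 mulr1 mul1r.
have h : a * (b ^+ n.+1 - a ^+ n.+1) <= b * (b ^+ n.+1 - a ^+ n.+1).
  have [ab|ba] := leP a b.
    by rewrite ler_wpM2r// subr_ge0 lerXn2r.
  by rewrite ler_wnM2r ?ltW// subr_lt0 ltrXn2r.
have := ler_wpM2l b0 IH; rewrite -[n.+2%:R]natr1.
have : b ^+ n.+2 - a ^+ n.+2 = b ^+ n.+1 * (b - a) + a * (b ^+ n.+1 - a ^+ n.+1).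
  by rewrite !(exprS _ n.+1); ring.
have : b * (n.+1%:R * b ^+ n * (b - a)) = n.+1%:R * b ^+ n.+1 * (b - a).
  by rewrite exprS; ring.
move: h; lra.
Qed.

(** The tangent inequality for powers followed by Cauchy-Schwarz. The slope is the gradient of
    [N ^+ n.+2] at [y], written without dividing by [N y]. *)
Lemma pnorm_expn_convex n x y :
  N y ^+ n.+2 - N x ^+ n.+2 <= n.+2%:R * N y ^+ n * <[y, y - x]>.
Proof.
apply: le_trans (expr_convex n.+1 (pnorm_ge0 x) (pnorm_ge0 y)) _.
rewrite exprSr -!mulrA ler_wpM2l// ler_wpM2l ?exprn_ge0 ?pnorm_ge0//.
rewrite innerDr innerNr -(sqr_pnorm Bp) expr2 mulrBr lerD2l lerN2.
exact: inner_le_pnorm.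
Qed.

Lemma pnorm_line_cvg (u k : E) : N (u + s *: k) @[s --> (0 : R)] --> N u.
Proof.
have -> : (fun s : R => N (u + s *: k)) =
    (fun s => Num.sqrt (<[u, u]> + (s * (2 * <[u, k]>) + s * (s * <[k, k]>)))).
  apply/funext => s; rewrite /pnorm -/(inner _ _) !innerE (innerC Bs k u).
  by congr (Num.sqrt _); ring.
have -> : N u = Num.sqrt (<[u, u]> + (0 * (2 * <[u, k]>) + 0 * (0 * <[k, k]>))).
  by rewrite !mul0r !addr0.
apply: continuous_cvg; first exact: sqrt_continuous.
by apply: cvgD; [exact: cvg_cst | apply: cvgD; apply: cvgM;
  [exact: cvg_id | exact: cvg_cst | exact: cvg_id |
   apply: cvgM; [exact: cvg_id | exact: cvg_cst]]].
Qed.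

Lemma pnorm_expn_line_cvg n (u k : E) :
  N (u + s *: k) ^+ n @[s --> (0 : R)] --> N u ^+ n.
Proof.
elim: n => [|n IH]; first exact: cvg_cst.
rewrite exprS; under eq_fun do rewrite exprS.
by apply: cvgM => //; exact: pnorm_line_cvg.
Qed.

(** Serves to let the step [s] tend to 0 from the right once a first-order inequality has been
    divided by [s]. *)
Lemma ge0_right_limit (phi : R -> R) d : 0 < d ->
  phi s @[s --> (0 : R)] --> phi 0 ->
  (forall s, 0 < s < d -> 0 <= phi s) -> 0 <= phi 0.
Proof.
move=> d0 /cvg_at_right_filter c h.
apply: (cvgr_to_ge c); near=> s; apply: h; apply/andP; split.
  by near: s; exact: nbhs_right_gt.
by near: s; exact: nbhs_right_lt.
Unshelve. all: by end_near. Qed.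

End ConvexPowers.

(** * Convexity along segments, and convexity of the domain and of the finite part of [psi] *)

Section SegmentConvexity.
Context {R : realType} {E : vectType R}.

Definition segment_convex (D : set E) : Prop := forall x y (s : R),
  D x -> D y -> 0 <= s <= 1 -> D (x + s *: (y - x)).

Definition segment_convex_on (D : set E) (g : E -> R) : Prop := forall x y (s : R),
  D x -> D y -> 0 <= s <= 1 ->
  g (x + s *: (y - x)) <= (1 - s) * g x + s * g y.

Lemma convE (s : R) (s0 : 0 <= s) (s1 : s <= 1) (x y : convex_lmodType E) :
  conv (Itv01 s0 s1) y x = (x : E) + s *: ((y : E) - (x : E)).
Proof.
rewrite [LHS](_ : _ = s *: (y : E) + (1 - s) *: (x : E))//.
by rewrite scalerBl scale1r scalerBr addrCA.
Qed.

Lemma segment_convex_function (D : set E) (f : E -> R) :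
  convex_function D f -> segment_convex_on D f.
Proof.
move=> hf x y s Dx Dy /andP[s0 s1].
have := hf (Itv01 s0 s1) y x (mem_set Dy) (mem_set Dx).
by rewrite convE convRE [X in _ <= X]addrC.
Qed.

Variables (B : 'Hom(E, dual E)) (psi : E -> \bar R).
Hypotheses (psip : proper_function psi) (psic : closed_convex B psi).
Local Notation D := (effdom psi).

Lemma fine_psiK x : D x -> psi x = (fine (psi x))%:E.
Proof.
move=> Dx; rewrite fineK// fin_numE; case: psip => /(_ x) nx _.
by rewrite nx -ltey.
Qed.

(** Convexity of the epigraph at two points of the graph. Kept extended-valued, it yields both the
    convexity of the domain and that of [fine \o psi] on it. *)
Lemma segment_epigraph x y (s : R) : D x -> D y -> 0 <= s <= 1 ->
  (psi (x + s *: (y - x))%R <= ((1 - s) * fine (psi x) + s * fine (psi y))%:E)%E.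
Proof.
move=> Dx Dy /andP[s0 s1]; case: psic => hc _.
pose X : convex_lmodType (E * R^o)%type := (x, fine (psi x) : R^o).
pose Y : convex_lmodType (E * R^o)%type := (y, fine (psi y) : R^o).
have eX : X \in epigraph psi by rewrite inE /epigraph/= -fine_psiK.
have eY : Y \in epigraph psi by rewrite inE /epigraph/= -fine_psiK.
have := hc Y X (Itv01 s0 s1) eY eX; rewrite inE /epigraph/=.
have -> : s *: y + unstable.onem s *: x = x + s *: (y - x).
  by rewrite /unstable.onem scalerBl scale1r scalerBr addrCA.
by rewrite [s *: _ + _]addrC.
Qed.

Lemma segment_convex_effdom : segment_convex D.
Proof.
move=> x y s Dx Dy s01.
by rewrite /effdom /= (le_lt_trans (segment_epigraph Dx Dy s01))// ltry.
Qed.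

Lemma segment_convex_fine : segment_convex_on D (fun x => fine (psi x)).
Proof.
move=> x y s Dx Dy s01; rewrite -lee_fin -fine_psiK.
  exact: segment_epigraph.
exact: segment_convex_effdom.
Qed.

End SegmentConvexity.

(** * The gradient inequality and the Taylor remainder of the gradient *)

Section TaylorRemainder.
Context {R : realType} {E : vectType R} {B : 'Hom(E, dual E)}.
Hypotheses (Bs : self_adjoint B) (Bp : positive_definite B).
Local Notation N := (pnorm B).
Variables (D : set E) (p : nat) (f : E -> R) (Df : forall i, E -> mform E i).
Hypotheses (Dc : segment_convex D) (hf : Cp_on B D p f Df).

Lemma gradient_ineq x y : (0 < p)%N -> segment_convex_on D f -> D x -> D y ->
  f x + ((Df 1 x : 'Hom(E, R^o)) (y - x) : R) <= f y.
Proof.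
move=> p0 fc Dx Dy; apply/ler_addgt0Pr => e e0.
set k := y - x; set G : 'Hom(E, R^o) := Df 1 x.
have k1 : 0 < N k + 1 by rewrite ltr_wpDl ?pnorm_ge0.
have [d d0 hd] := Cp_onS hf p0 Dx (divr_gt0 e0 k1).
(* Short enough for [x + s *: k] to stay on the segment and within distance [d] of [x]; the error is
   then at most [s * e], and [s] is divided out at the end. *)
pose s : R := Num.min 1 (d / (2 * (N k + 1))).
have s0 : 0 < s by rewrite lt_min ltr01/= divr_gt0// mulr_gt0.
have s1 : s <= 1 by rewrite ge_min lexx.
have s01 : 0 <= s <= 1 by rewrite (ltW s0).
have sd : s * N k < d.
  have : s * (2 * (N k + 1)) <= d.
    by rewrite -ler_pdivlMr ?mulr_gt0// ge_min lexx orbT.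
  have : 0 <= s * N k by rewrite mulr_ge0 ?pnorm_ge0// ltW.
  move: s0; lra.
have Dz := Dc Dx Dy s01.
have hz : x + s *: k - x = s *: k by rewrite addrC addKr.
have Gs : (G (s *: k) : R) = s * (G k : R) by rewrite linearZ.
have := hd _ Dz; rewrite -/k hz (mnorm0E (B := B)) pnormZ// (ger0_norm (ltW s0)).
move=> /(_ sd); rewrite !(Cp_on0 hf)// -/G Gs ler_norml => /andP[h _].
have h2 := fc _ _ _ Dx Dy s01; rewrite -/k in h2.
have h3 : e / (N k + 1) * (s * N k) <= s * e.
  have -> : e / (N k + 1) * (s * N k) = s * e * (N k / (N k + 1)) by ring.
  rewrite -[leRHS]mulr1 ler_wpM2l ?mulr_ge0 ?(ltW e0) ?(ltW s0)//.
  by rewrite ler_pdivrMr// mul1r lerDl.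
rewrite -subr_ge0 -(pmulr_rge0 _ s0); move: h h2 h3; lra.
Qed.

Hypothesis (p0 : (0 < p)%N).
Variable (L : R).
Hypothesis (fL : mform_lipschitz_on B D (Df p) L).

(** Scalar Taylor expansion of order [p.-1] for the derivative in direction [h] along the segment.
    Its last derivative grows at rate at most [L * N d ^+ p * N h]: [p.-1] factors [N d] come from
    the slots, one from the Lipschitz condition. *)
Lemma taylor_remainder v T h : D v -> D T ->
  ((Df 1 T : 'Hom(E, R^o)) h : R) - (taylor_gradient p Df v T h : R) <=
  L / p`!%:R * N (T - v) ^+ p * N h.
Proof.
move=> Dv DT; set d := T - v.
pose q j (s : R) : R := mslice (Df j.+1 (v + s *: d)) d h.
have Dz s : 0 <= s <= 1 -> D (v + s *: d) by move=> s01; exact: Dc.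
have Nz r s : N ((v + r *: d) - (v + s *: d)) = `|r - s| * N d.
  by rewrite opprD addrACA subrr add0r -scalerBl pnormZ.
have prodE j : \prod_(z <- cons_tuple h (nseq_tuple j d)) N z = N h * N d ^+ j.
  by rewrite big_cons big_nseq iter_mulr_1.
have qd j : (j < p.-1)%N -> derive_on_unit (q j) (q j.+1).
  move=> jp s s01 e e0; have jp' : (j.+1 < p)%N by rewrite -ltn_predRL.
  have C1 : 0 < N d * (N h * N d ^+ j) + 1.
    by rewrite ltr_wpDl// !mulr_ge0 ?exprn_ge0 ?pnorm_ge0.
  have [dl dl0 hdl] := Cp_onS hf jp' (Dz s s01) (divr_gt0 e0 C1).
  have d1 : 0 < N d + 1 by rewrite ltr_wpDl ?pnorm_ge0.
  exists (dl / (N d + 1)) => [|r r01]; first by rewrite divr_gt0.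
  rewrite ltr_pdivlMr// => hr.
  have {}hr : N ((v + r *: d) - (v + s *: d)) < dl.
    by rewrite Nz; apply: le_lt_trans hr; rewrite ler_wpM2l// lerDl.
  have hm := hdl _ (Dz r r01) hr; rewrite Nz in hm.
  set A : mform E j.+1 := (X in mnorm _ X) in hm.
  have -> : q j r - q j s - q j.+1 s * (r - s) =
      mapp A (cons_tuple h (nseq_tuple j d)).
    rewrite /A !mappB; congr (_ - _ - _).
    rewrite opprD addrACA subrr add0r -scalerBl linearZ mappZ mulrC; congr (_ * _).
    (* Differentiation puts the new [d] in the first slot; symmetry moves it behind [h]. *)
    rewrite -mapp_cons; apply: (Cp_on_sym hf jp' (Dz s s01)).
    by rewrite /= (perm_catCA [:: h] [:: d] (nseq j d)).
  apply: le_trans (mapp_le_mnorm Bs Bp _ _) _; rewrite prodE.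
  have P0 : 0 <= N h * N d ^+ j by rewrite mulr_ge0 ?exprn_ge0 ?pnorm_ge0.
  apply: le_trans (ler_wpM2r P0 hm) _.
  have -> : e / (N d * (N h * N d ^+ j) + 1) * (`|r - s| * N d) * (N h * N d ^+ j) =
    e * `|r - s| * (N d * (N h * N d ^+ j) / (N d * (N h * N d ^+ j) + 1)) by ring.
  rewrite -[leRHS]mulr1 ler_wpM2l ?mulr_ge0 ?(ltW e0)//.
  by rewrite ler_pdivrMr// mul1r lerDl.
have qL s : 0 <= s <= 1 -> q p.-1 s - q p.-1 0 <= L * N d ^+ p * N h * s.
  move=> s01; rewrite /q /mslice -mappB.
  apply: le_trans (ler_norm _) _; apply: le_trans (mapp_le_mnorm Bs Bp _ _) _.
  rewrite prodE prednK//.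
  have z01 : 0 <= (0 : R) <= 1 by rewrite lexx ler01.
  have := fL (Dz s s01) (Dz 0 z01); rewrite Nz subr0 => hL.
  have P0 : 0 <= N h * N d ^+ p.-1 by rewrite mulr_ge0 ?exprn_ge0 ?pnorm_ge0.
  apply: le_trans (ler_wpM2r P0 hL) _.
  case/andP: s01 => s0 _; rewrite ger0_norm// le_eqVlt; apply/orP; left; apply/eqP.
  by rewrite -[in RHS](prednK p0) exprS; ring.
have o01 : 0 <= (1 : R) <= 1 by rewrite ler01 lexx.
have := scalar_taylor qd qL o01; rewrite prednK// expr1n mulr1.
rewrite /q /mslice scale1r [v + d]addrC subrK mapp_cons.
rewrite taylor_gradientE -/d.
under eq_bigr do rewrite expr1n mulr1 scale0r addr0.
move/le_trans; apply.
by rewrite le_eqVlt; apply/orP; left; apply/eqP; ring.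
Qed.

End TaylorRemainder.

(** * The tensor step *)

Section StepInequalities.
Context {R : realType}.

(** Add [1 + ln (x / z) <= x / z] and its analogue for [y] with weights [a] and [b]; the logarithms
    cancel. Naming the geometric mean [z] avoids roots. *)
Lemma weighted_amgm (a b : nat) (x y z : R) : 0 < x -> 0 < y -> 0 < z ->
  z ^+ (a + b) = x ^+ a * y ^+ b -> (a + b)%:R * z <= a%:R * x + b%:R * y.
Proof.
move=> x0 y0 z0 h.
have hl : ln z * (a%:R + b%:R) = ln x * a%:R + ln y * b%:R.
  by rewrite -natrD !mulr_natr -!lnXn// h lnM ?posrE ?exprn_gt0.
have hx : 1 + (ln x - ln z) <= x / z.
  by rewrite -ln_div ?posrE// (le_trans (expR_ge1Dx _))// lnK// posrE divr_gt0.
have hy : 1 + (ln y - ln z) <= y / z.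
  by rewrite -ln_div ?posrE// (le_trans (expR_ge1Dx _))// lnK// posrE divr_gt0.
rewrite -ler_pdivlMr//.
have -> : (a%:R * x + b%:R * y) / z = a%:R * (x / z) + b%:R * (y / z) by ring.
have := ler_wpM2l (ler0n R a) hx; have := ler_wpM2l (ler0n R b) hy.
move: hl; rewrite natrD.
move: (x / z) (y / z) (ln x) (ln y) (ln z) a%:R b%:R => X Y lx ly lz ra rb; lra.
Qed.

Lemma gamma_rate_gt0 p (L M : R) : (0 < p)%N -> 0 < L -> p%:R * L <= M ->
  0 < gamma_rate p L M.
Proof.
move=> p0 L0 LM.
have M0 : 0 < M by rewrite (lt_le_trans _ LM)// mulr_gt0// ltr0n.
rewrite /gamma_rate; apply: mulr_gt0.
  apply: mulr_gt0; first by rewrite divr_gt0// ltr0n.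
  by rewrite powR_gt0// divr_gt0// ltr0n fact_gt0.
case: ifP => // /negbT p1; rewrite powR_gt0// divr_gt0// subr_gt0.
  rewrite ltrXn2r ?nnegrE ?ltW//; apply: lt_le_trans LM.
  by rewrite ltr_pMl// ltr1n ltn_neqAle eq_sym p1.
by rewrite expr_gt1// ltr1n ltn_neqAle eq_sym p1.
Qed.

(** With weights [n.+2] and [n] the powers of [rho] cancel, so the geometric mean gives a bound
    independent of [rho]. *)
Lemma amgm_balance n (m K w rho Q : R) : m != 0 -> rho != 0 ->
  K ^+ (2 * n.+1) = Q ^+ n ->
  (m * K * w ^+ n.+2) ^+ (2 * n.+1) =
    (m ^+ n.+1 * w ^+ (2 * n.+1) / rho ^+ n) ^+ n.+2
    * (Q * rho ^+ n.+2 / m ^+ n.+1) ^+ n.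
Proof.
move=> m0 r0 KE.
have eP : m ^+ (2 * n.+1) * (m ^+ n.+1) ^+ n = (m ^+ n.+1) ^+ n.+2.
  by rewrite -!exprM -exprD (mulnC 2) -mulnDr.
have eW : (w ^+ n.+2) ^+ (2 * n.+1) = (w ^+ (2 * n.+1)) ^+ n.+2 by rewrite exprAC.
have eR : (rho ^+ n.+2) ^+ n = (rho ^+ n) ^+ n.+2 by rewrite exprAC.
have P0 : m ^+ n.+1 != 0 by rewrite expf_neq0.
have Rn0 : rho ^+ n != 0 by rewrite expf_neq0.
move: eP eW eR P0 Rn0.
move: (m ^+ n.+1) (w ^+ n.+2) (w ^+ (2 * n.+1)) (rho ^+ n) (rho ^+ n.+2).
move=> P w2 W Rn R2 eP eW eR P0 Rn0.
rewrite !exprMn KE eW !exprVn eR -eP.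
by field; rewrite !expf_neq0.
Qed.

(* [w] is the p-th root of [|V|], which keeps all exponents integral; [rho] is
   [|T - v|] and [X] is [<V, v - T>].  [gamma_rate] comes from minimizing over
   [rho]. *)
Lemma gamma_rate_descent p (L M w rho X : R) : (0 < p)%N -> 0 < L ->
  p%:R * L <= M -> 0 < w -> 0 <= rho ->
  w ^+ (2 * p) + (M ^+ 2 - L ^+ 2) / p`!%:R ^+ 2 * rho ^+ (2 * p) <=
    2 * (M / p`!%:R * rho ^+ p.-1) * X ->
  gamma_rate p L M * w ^+ p.+1 <= X.
Proof.
move=> p0 L0 LM w0 rho0.
have M0 : 0 < M by rewrite (lt_le_trans _ LM)// mulr_gt0// ltr0n.
case: p p0 LM => [//|n] _ LM.
have [F FE] : exists F : R, F = n.+1`!%:R by exists n.+1`!%:R.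
rewrite /gamma_rate -FE; have F0 : 0 < F by rewrite FE ltr0n fact_gt0.
(* For [p = 1] the right side carries no power of [rho], and the nonnegative [rho] term on the left
   is dropped. *)
have [n0|n0] := posnP n.
  subst n; have F1 : F = 1 by rewrite FE.
  rewrite F1 /= !invr1 expr1n ?invr1 !mulr1 ?expr0 ?mulr1 powRr1; last by lra.
  rewrite muln1 mul1r => h.
  have h1 : 0 <= (M ^+ 2 - L ^+ 2) * rho ^+ 2.
    rewrite !mulr_ge0 ?exprn_ge0// subr_ge0 lerXn2r ?nnegrE ?(ltW L0) ?(ltW M0)//.
    by move: LM; rewrite mul1r.
  have -> : M^-1 * (1 / 2) * w ^+ 2 = w ^+ 2 / (2 * M) by field; rewrite gt_eqF.
  by rewrite ler_pdivrMr ?mulr_gt0//; move: h h1; lra.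
rewrite eqSS gtn_eqF//.
set m := _ `^ _; set Q := (M ^+ 2 - L ^+ 2) / (n.+1%:R ^+ 2 - 1); set K := Q `^ _ => h.
have p1 : (1 : R) < n.+1%:R by rewrite ltr1n.
have hn : (n.+1%:R : R) = n%:R + 1 by rewrite natr1.
have nn : (n.+2 + n = 2 * n.+1)%N by rewrite mul2n -addnn addnS.
have Q0 : 0 < Q.
  rewrite divr_gt0 ?subr_gt0 ?expr_gt1//.
  rewrite ltrXn2r ?nnegrE ?(ltW L0) ?(ltW M0)//; apply: lt_le_trans LM.
  by rewrite ltr_pMl.
have m0 : 0 < m by rewrite powR_gt0// divr_gt0// ltr0n.
have K0 : 0 < K by rewrite powR_gt0.
have mE : m ^+ n.+1 = F / n.+2%:R.
  rewrite -powR_mulrn ?(ltW m0)// -powRrM mulVf ?pnatr_eq0// powRr1//.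
  by rewrite divr_ge0// ltW.
have KE : K ^+ (2 * n.+1) = Q ^+ n.
  rewrite -powR_mulrn ?(ltW K0)// -powRrM natrM mulfVK.
    by rewrite hn addrK powR_mulrn// ltW.
  by rewrite mulf_neq0// pnatr_eq0.
(* The factors of [p^2 - 1 = (p - 1) * (p + 1)] are the two weights of the AM-GM inequality. *)
have QE : M ^+ 2 - L ^+ 2 = Q * (n%:R * n.+2%:R).
  rewrite /Q (_ : n.+1%:R ^+ 2 - 1 = n%:R * n.+2%:R); last first.
    by rewrite -(natr1 n.+1) hn; ring.
  by rewrite mulfVK// mulf_neq0 ?pnatr_eq0// -lt0n.
(* For [p >= 2], [rho = 0] would annihilate the right side of [h] but not the positive left side. *)
have r0 : 0 < rho.
  rewrite lt_def rho0 andbT; apply: contraTneq h => ->.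
  rewrite -ltNge /= !expr0n /= gtn_eqF//= !mulr0 mul0r addr0.
  by rewrite exprn_gt0.
(* [Xa] and [Yb] are the two terms on the left of [h], multiplied by [F / rho ^+ n] and divided by
   their weights. *)
pose Xa := m ^+ n.+1 * w ^+ (2 * n.+1) / rho ^+ n.
pose Yb := Q * rho ^+ n.+2 / m ^+ n.+1.
have rn0 k : 0 < rho ^+ k by rewrite exprn_gt0.
have mn0 : 0 < m ^+ n.+1 by rewrite exprn_gt0.
have Xa0 : 0 < Xa by rewrite divr_gt0// mulr_gt0// exprn_gt0.
have Yb0 : 0 < Yb by rewrite divr_gt0// mulr_gt0.
have Z0 : 0 < m * K * w ^+ n.+2 by rewrite mulr_gt0 ?exprn_gt0// mulr_gt0.
have Zp : (m * K * w ^+ n.+2) ^+ (n.+2 + n) = Xa ^+ n.+2 * Yb ^+ n.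
  by rewrite nn; apply: amgm_balance; rewrite ?gt_eqF.
have := weighted_amgm Xa0 Yb0 Z0 Zp.
have -> : n.+2%:R * Xa + n%:R * Yb =
    F / rho ^+ n * (w ^+ (2 * n.+1) + (M ^+ 2 - L ^+ 2) / F ^+ 2 * rho ^+ (2 * n.+1)).
  have -> : rho ^+ (2 * n.+1) = rho ^+ n.+2 * rho ^+ n.
    by rewrite -exprD nn.
  rewrite QE /Xa /Yb mE; field.
  by rewrite !gt_eqF ?rn0 ?F0//= ltr0n.
have FF : 0 <= F / rho ^+ n by rewrite divr_ge0// ltW.
have := ler_wpM2l FF h => /[swap] h1 /(le_trans h1) /=.
have -> : F / rho ^+ n * (2 * (M / F * rho ^+ n) * X) = 2 * M * X.
  by field; rewrite !gt_eqF ?rn0.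
have -> : (n.+2 + n)%:R = 2 * n.+1%:R :> R by rewrite -natrM nn.
move=> h2; have -> : n.+1%:R / M * m * K * w ^+ n.+2 =
  n.+1%:R * (m * K * w ^+ n.+2) / M by ring.
rewrite ler_pdivrMr//; move: h2; lra.
Qed.

End StepInequalities.

(** * Optimality and descent for one tensor step *)

Section TensorStepTheory.
Context {R : realType} {E : vectType R} {B : 'Hom(E, dual E)}.
Hypotheses (Bs : self_adjoint B) (Bp : positive_definite B).
Local Notation N := (pnorm B).
Local Notation "<[ x , y ]>" := (inner (B := B) x y).
Variables (psi : E -> \bar R) (f : E -> R) (p : nat).
Variables (Df : forall i, E -> mform E i) (L M : R).
Local Notation D := (effdom psi).
Hypotheses (Dc : segment_convex D) (psic : segment_convex_on D (fun x => fine (psi x))).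
Hypotheses (p0 : (0 < p)%N) (fc : segment_convex_on D f) (hf : Cp_on B D p f Df).
Hypotheses (L0 : 0 < L) (fL : mform_lipschitz_on B D (Df p) L) (LM : p%:R * L <= M).
Variables (v T : E).
Hypotheses (Dv : D v) (hT : is_tensor_step B psi Df p M v T).
Local Notation V := (reduced_gradient B Df p M v T).
Local Notation d := (T - v).

Let M0 : 0 < M.
Proof. by rewrite (lt_le_trans _ LM)// mulr_gt0// ltr0n. Qed.

Let Dfs i : (i <= p)%N -> msymmetric (Df i v).
Proof. by move=> ip; exact: (Cp_on_sym hf ip Dv). Qed.

Lemma tensor_step_dom : D T.
Proof. by case: hT. Qed.

Lemma reduced_gradientE h : (V h : R) = ((Df 1 T : 'Hom(E, R^o)) h : R)
  - (taylor_gradient p Df v T h : R) - M / p`!%:R * N d ^+ p.-1 * <[d, h]>.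
Proof.
rewrite /reduced_gradient (gradient_taylor Bs Bp Dfs).
by rewrite !add_lfunE !opp_lfunE scale_lfunE.
Qed.

(** Compare [T] with the points [T + s *: (y - T)], divide by [s] and let [s] tend to 0. Thus [V]
    minus the gradient of [f] at [T] is a subgradient of [psi] there. *)
Lemma tensor_step_optimality y : D y ->
  fine (psi T) + ((V (y - T) : R) - ((Df 1 T : 'Hom(E, R^o)) (y - T) : R))
    <= fine (psi y).
Proof.
move=> Dy; have [DT Tmin] := hT.
rewrite reduced_gradientE; set k := y - T; set u := T - v.
set G := (taylor_gradient p Df v T k : R).
have [K K0 hK] := taylor_expansion Bs Bp Dfs T.
(* An upper bound for the difference quotient of the model. The slope of the norm power is taken at
   the moved point, so its continuity in [s] is needed. *)
pose phi (s : R) := (fine (psi y) - fine (psi T) + G) + (s * (K * N k ^+ 2)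
  + (M / p`!%:R * N (u + s *: k) ^+ p.-1) * (<[u, k]> + s * N k ^+ 2)).
suff : 0 <= phi 0.
  rewrite /phi scale0r addr0 !mul0r addr0 add0r.
  move: (<[u, k]>) (N u ^+ _) => i c; set g := (Df 1 T : 'Hom(E, R^o)) k.
  rewrite addrAC; lra.
have k1 : 0 < N k + 1 by rewrite ltr_wpDl ?pnorm_ge0.
(* Below this threshold [s *: k] lies in the unit ball, as [taylor_expansion] requires. *)
have d0 : 0 < Num.min 1 (N k + 1)^-1 by rewrite lt_min ltr01 invr_gt0.
apply: (ge0_right_limit d0).
  rewrite /phi; apply: cvgD; first exact: cvg_cst.
  apply: cvgD; first by apply: cvgM; [exact: cvg_id | exact: cvg_cst].
  apply: cvgM.
    apply: cvgM; first exact: cvg_cst.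
    rewrite scale0r addr0.
    exact: pnorm_expn_line_cvg.
  apply: cvgD; first exact: cvg_cst.
  by apply: cvgM; [exact: cvg_id | exact: cvg_cst].
move=> s; rewrite lt_min => /andP[s0 /andP[s1 sk]].
have s01 : 0 <= s <= 1 by rewrite !ltW.
have Dz := Dc DT Dy s01; have := Tmin _ Dz; have := psic DT Dy s01; rewrite -/k.
have Nsk : N (s *: k) = s * N k by rewrite pnormZ// ger0_norm// ltW.
have Nsk1 : N (s *: k) <= 1.
  move: sk; rewrite -[_^-1]mul1r ltr_pdivlMr// Nsk; move: s0; lra.
have := hK _ Nsk1; rewrite Nsk ler_norml => /andP[_].
have -> : (taylor_gradient p Df v T (s *: k) : R) = s * G by rewrite linearZ.
have : N (u + s *: k) ^+ p.+1 - N u ^+ p.+1 <=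
    s * (p.+1%:R * N (u + s *: k) ^+ p.-1 * (<[u, k]> + s * N k ^+ 2)).
  have := pnorm_expn_convex Bs Bp p.-1 u (u + s *: k); rewrite prednK//.
  move/le_trans; apply; rewrite [u + s *: k]addrC addrK addrC innerZr innerDl innerZl.
  by rewrite -(sqr_pnorm Bp) le_eqVlt; apply/orP; left; apply/eqP; ring.
have -> : T + s *: k - v = u + s *: k by rewrite addrAC.
rewrite -/u; set a := N (u + s *: k) ^+ p.+1; set b := N u ^+ p.+1.
set c := N (u + s *: k) ^+ p.-1; set i := _ + s * N k ^+ 2.
have F0 : 0 < (p.+1`!%:R : R) by rewrite ltr0n fact_gt0.
have Fe : (p.+1`!%:R : R) = p.+1%:R * p`!%:R by rewrite factS natrM.
move=> h1 h2 h3 h4.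
have {}h1 : M / p.+1`!%:R * (a - b) <= s * (M / p`!%:R * c * i).
  have -> : s * (M / p`!%:R * c * i) = M / p.+1`!%:R * (s * (p.+1%:R * c * i)).
    by rewrite Fe; field; rewrite pnatr_eq0 -lt0n fact_gt0/= addrC natr1 pnatr_eq0.
  by rewrite ler_wpM2l// divr_ge0// ltW.
rewrite -(pmulr_rge0 _ s0) /phi -/i -/c; move: h1 h2 h3 h4.
move: (taylor _ _ _ _) (taylor _ _ _ _) (fine _) (fine _) (fine _) => t1 t2 f1 f2 f3.
lra.
Qed.

Lemma objective_subgradient y : D y ->
  objective f psi T + (V (y - T) : R) <= objective f psi y.
Proof.
move=> Dy; have DT := tensor_step_dom.
have := tensor_step_optimality Dy; have := gradient_ineq Bp Dc hf p0 fc DT Dy.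
rewrite /objective; lra.
Qed.

Lemma reduced_gradient_sqr : dnorm B V ^+ (2) +
    (M ^+ 2 - L ^+ 2) / p`!%:R ^+ 2 * N d ^+ (2 * p) <=
  2 * (M / p`!%:R * N d ^+ p.-1) * (V (v - T) : R).
Proof.
set c := M / p`!%:R * N d ^+ p.-1; set K := L / p`!%:R * N d ^+ p.
have K0 : 0 <= K by rewrite mulr_ge0 ?divr_ge0 ?exprn_ge0 ?pnorm_ge0// ltW.
set u := riesz (B := B) V.
have uE h : <[u, h]> = ((Df 1 T : 'Hom(E, R^o)) h : R)
  - (taylor_gradient p Df v T h : R) - c * <[d, h]>.
  by rewrite -(rieszE Bp) reduced_gradientE.
set z := u + c *: d.
(* [z] represents the Taylor remainder of the gradient, which is tested here against [z] itself. *)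
have zK : N z ^+ 2 <= K * N z.
  rewrite (sqr_pnorm Bp) [X in X <= _]innerDl innerZl uE subrK.
  exact: (taylor_remainder Bs Bp Dc hf p0 fL _ Dv tensor_step_dom).
have {}zK : N z ^+ 2 <= K ^+ 2.
  have [zl|zl] := leP (N z) K.
    by rewrite lerXn2r ?nnegrE ?pnorm_ge0.
  have z0 : 0 < N z by rewrite (le_lt_trans K0).
  by move: zK; rewrite expr2 ler_pM2r// leNgt zl.
have zE : N z ^+ 2 = dnorm B V ^+ 2 + 2 * c * (V d : R) + c ^+ 2 * N d ^+ 2.
  rewrite (dnormE Bp) (rieszE Bp V d) -/u /z; move: (T - v) => e.
  by rewrite !(sqr_pnorm Bp) !innerE (innerC Bs e u); ring.
have -> : (V (v - T) : R) = - (V d : R) by rewrite -[v - T]opprB linearN.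
have cE : c ^+ 2 * N d ^+ 2 - K ^+ 2 = (M ^+ 2 - L ^+ 2) / p`!%:R ^+ 2 * N d ^+ (2 * p).
  rewrite /c /K !exprMn -!exprM !(mulnC _ 2%N).
  have -> : N d ^+ (2 * p) = N d ^+ (2 * p.-1) * N d ^+ 2.
    by rewrite -exprD -[in LHS](prednK p0) mulnS addnC.
  by rewrite exprVn; ring.
move: zK zE cE; lra.
Qed.

Hypothesis (V0 : V != 0).

Lemma reduced_gradient_descent w : 0 < w -> w ^+ p = dnorm B V ->
  gamma_rate p L M * w ^+ p.+1 <= (V (v - T) : R).
Proof.
move=> w0 wE; apply: (gamma_rate_descent p0 L0 LM w0 (pnorm_ge0 (B := B) d)).
by have := reduced_gradient_sqr; rewrite -wE -exprM mulnC.
Qed.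

Lemma stepsizeE : stepsize B Df p M v T * dnorm B V ^+ 2 = (V (v - T) : R).
Proof. by rewrite /stepsize mulfVK// expf_neq0// gt_eqF// dnorm_gt0. Qed.

Lemma stepsize_gt0 : 0 < stepsize B Df p M v T.
Proof.
have g0 := dnorm_gt0 Bp V0.
have w0 : 0 < dnorm B V `^ p%:R^-1 by rewrite powR_gt0.
have wE : (dnorm B V `^ p%:R^-1) ^+ p = dnorm B V.
  by rewrite -powR_mulrn ?ltW// -powRrM mulVf ?powRr1 ?ltW// pnatr_eq0 -lt0n.
rewrite /stepsize divr_gt0 ?exprn_gt0//.
apply: lt_le_trans (reduced_gradient_descent w0 wE).
by rewrite mulr_gt0 ?exprn_gt0// gamma_rate_gt0.
Qed.

End TensorStepTheory.

(** * Rates of convergence *)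

Section Rates.
Context {R : realType}.

(* The tangent line of the convex function [z |-> z^(-n/2)] at [1], for
   [z = x^2]. *)
Lemma expn_tangent n (x : R) : 0 < x -> x ^+ n * (1 + n%:R / 2 * (1 - x ^+ 2)) <= 1.
Proof.
move=> x0; have xn0 : 0 < x ^+ n by rewrite exprn_gt0.
have h1 : 1 + ln (x ^+ 2) <= x ^+ 2.
  by rewrite (le_trans (expR_ge1Dx _))// lnK// posrE exprn_gt0.
have h2 : 1 + ln (x ^+ n)^-1 <= (x ^+ n)^-1.
  by rewrite (le_trans (expR_ge1Dx _))// lnK// posrE invr_gt0.
rewrite lnXn// in h1; rewrite lnV ?posrE// lnXn// -mulr_natl in h2.
rewrite mulrC -ler_pdivlMr// div1r; apply: le_trans h2.
have := ler_wpM2l (ler0n R n) h1; move: (ln x) (x ^+ 2) n%:R => l y m; lra.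
Qed.

Lemma powR_half n (x : R) : 0 <= x -> x `^ (n%:R / 2) = Num.sqrt x ^+ n.
Proof.
by move=> x0; rewrite mulrC powRrM powR12_sqrt// powR_mulrn// sqrtr_ge0.
Qed.

(** The scalar content of both methods: [g i] stands for the norm of the reduced gradient, [w i] for
    its p-th root and [delta i] for the gap in the objective at [x i]. *)
Variables (p t : nat) (gamma r : R) (a g w delta : nat -> R).
Hypotheses (p0 : (0 < p)%N) (t0 : (0 < t)%N) (gamma0 : 0 < gamma) (r0 : 0 <= r).
Hypothesis (a0 : forall i, (0 < i < t.+1)%N -> 0 < a i).
Hypothesis (w0 : forall i, (0 < i < t.+1)%N -> 0 < w i).
Hypothesis (wE : forall i, (0 < i < t.+1)%N -> w i ^+ p = g i).
Hypothesis (ha : forall i, (0 < i < t.+1)%N -> gamma * w i ^+ p.+1 <= a i * g i ^+ 2).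
Hypothesis (d0 : forall i, (0 < i < t.+1)%N -> 0 <= delta i).
Hypothesis (hs : \sum_(1 <= i < t.+1) a i * delta i
  + 2^-1 * (\sum_(1 <= i < t.+1) (a i * g i) ^+ 2) <= 2^-1 * r ^+ 2).

Let sum_cst (c : R) : \sum_(1 <= i < t.+1) c = c * t%:R.
Proof. by rewrite sumr_const_nat subn1 mulr_natr. Qed.

Let g0 i : (0 < i < t.+1)%N -> 0 < g i.
Proof. by move=> it; rewrite -wE// exprn_gt0// w0. Qed.

Let step_ge i : (0 < i < t.+1)%N -> gamma * w i <= a i * g i.
Proof.
move=> it; rewrite -(ler_pM2r (g0 it)) -[leRHS]mulrA -expr2.
by apply: le_trans (ha it); rewrite -mulrA -(wE it) -exprS.
Qed.

Let sum_sqr_le : \sum_(1 <= i < t.+1) (a i * g i) ^+ 2 <= r ^+ 2.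
Proof.
have : 0 <= \sum_(1 <= i < t.+1) a i * delta i.
  by rewrite big_nat; apply: sumr_ge0 => i it; rewrite mulr_ge0 ?d0// ltW// a0.
move: hs; lra.
Qed.

Lemma min_gradient_rate g_min : 0 <= g_min ->
  (forall i, (0 < i < t.+1)%N -> g_min <= g i) ->
  g_min <= (gamma^-1 * r) ^+ p * t%:R^-1 `^ (p%:R / 2).
Proof.
move=> gm0 gm; rewrite powR_half ?invr_ge0// -exprMn.
set om := g_min `^ p%:R^-1.
have om0 : 0 <= om by exact: powR_ge0.
have omE : om ^+ p = g_min.
  by rewrite -powR_mulrn// -powRrM mulVf ?powRr1// pnatr_eq0 -lt0n.
rewrite -omE lerXn2r ?nnegrE ?mulr_ge0 ?sqrtr_ge0 ?invr_ge0 ?(ltW gamma0)//.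
have omw i : (0 < i < t.+1)%N -> om <= w i.
  move=> it; rewrite -(ler_pXn2r p0) ?nnegrE ?(ltW (w0 it))//.
  by rewrite omE wE// gm.
have tR : 0 < (t%:R : R) by rewrite ltr0n.
have h : (gamma * om) ^+ 2 * t%:R <= r ^+ 2.
  apply: le_trans sum_sqr_le; rewrite -sum_cst; apply: ler_sum_nat => i it.
  have go : 0 <= gamma * om by rewrite mulr_ge0// ltW.
  have goi : gamma * om <= a i * g i.
    by apply: le_trans (step_ge it); rewrite ler_pM2l// omw.
  by rewrite lerXn2r ?nnegrE//; apply: le_trans goi.
have h2 : gamma * om <= r * Num.sqrt t%:R^-1.
  rewrite -(ler_pXn2r (n := 2)) ?nnegrE ?mulr_ge0 ?sqrtr_ge0 ?(ltW gamma0)//.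
  by rewrite [leRHS]exprMn sqr_sqrtr ?invr_ge0// ler_pdivlMr.
by rewrite -mulrA -(ler_pM2l gamma0) [leRHS]mulrA mulfV ?gt_eqF// mul1r.
Qed.

(** The p-th power of [gamma <= a i * w i ^+ p.-1], arranged to involve the products [a i * g i],
    whose squares have a bounded sum. *)
Let stepsize_ge i : (0 < i < t.+1)%N -> gamma ^+ p <= a i * (a i * g i) ^+ p.-1.
Proof.
move=> it; have wi := w0 it.
have h : gamma <= a i * w i ^+ p.-1.
  rewrite -(ler_pM2r wi); apply: le_trans (step_ge it) _.
  by rewrite -(wE it) -mulrA -exprSr prednK.
have -> : a i * (a i * g i) ^+ p.-1 = (a i * w i ^+ p.-1) ^+ p.
  rewrite -(wE it) [in LHS]exprMn mulrA -exprS prednK// exprMn -!exprM.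
  by rewrite mulnC.
by rewrite lerXn2r ?nnegrE ?(ltW gamma0)//; apply: le_trans h; exact: ltW.
Qed.

(** The weighted gaps are at most [(r ^+ 2 - S) / 2]. Tangent lines bound each [a i] below, hence
    [A] below by an affine function of [S], and the tangency point makes that function a multiple of
    [r ^+ 2 - S]. *)
Lemma averaged_rate :
  \sum_(1 <= i < t.+1) a i * delta i <= (\sum_(1 <= i < t.+1) a i) *
    (r ^+ p.+1 / p.+1%:R * gamma^-1 ^+ p * ((p%:R - 1) / p.+1%:R) `^ ((p%:R - 1) / 2)
     * t%:R^-1 `^ (p.+1%:R / 2)).
Proof.
pose S := \sum_(1 <= i < t.+1) (a i * g i) ^+ 2.
have hS : \sum_(1 <= i < t.+1) a i * delta i + 2^-1 * S <= 2^-1 * r ^+ 2 by exact: hs.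
have Sr : S <= r ^+ 2 by exact: sum_sqr_le.
set A := \sum_(1 <= i < t.+1) a i.
suff : (r ^+ 2 - S) / 2 <= A * (r ^+ p.+1 / p.+1%:R * gamma^-1 ^+ p *
    ((p%:R - 1) / p.+1%:R) `^ ((p%:R - 1) / 2) * t%:R^-1 `^ (p.+1%:R / 2)).
  by apply: le_trans; move: hS; lra.
have tR : 0 < (t%:R : R) by rewrite ltr0n.
have [n pE] : exists n, p = n.+1 by exists p.-1; rewrite prednK.
have hn : p%:R - 1 = n%:R :> R by rewrite pE -natr1 addrK.
rewrite hn !powR_half ?invr_ge0 ?divr_ge0//.
set rho := Num.sqrt (n%:R / p.+1%:R); set tau := Num.sqrt t%:R^-1.
have tau2 : tau ^+ 2 = t%:R^-1 by rewrite sqr_sqrtr ?invr_ge0.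
(* The common value of the [a i * g i] in the extremal case: the tangent line
   bound is used there. *)
pose b0 := rho * r * tau.
have -> : r ^+ p.+1 / p.+1%:R * gamma^-1 ^+ p * rho ^+ n * tau ^+ p.+1 =
    r ^+ 2 * b0 ^+ n / (p.+1%:R * gamma ^+ p * t%:R).
  have -> : p.+1 = (n + 2)%N by rewrite pE addn2.
  rewrite /b0 !exprMn !exprD tau2 exprVn.
  by field; rewrite !gt_eqF ?exprn_gt0 ?ltr0n//= addr_gt0.
have S_gt0 : 0 < S.
  rewrite /S big_ltn ?ltnS// ltr_pwDl//.
    by rewrite exprn_gt0// mulr_gt0 ?a0 ?g0.
  by apply: sumr_ge0 => i _; exact: sqr_ge0.
have rp : 0 < r.
  rewrite lt_def r0 andbT; apply: contraTneq S_gt0 => rz.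
  by rewrite -leNgt (le_trans Sr)// rz expr0n.
(* For [p = 1] the point [b0] is zero and admits no tangent, but then every [a i] is at least
   [gamma]. *)
have [n0|n0] := posnP n.
  have p1 : p = 1%N by rewrite pE n0.
  have hA : gamma * t%:R <= A.
    rewrite -sum_cst; apply: ler_sum_nat => i it.
    by have := stepsize_ge it; rewrite p1 /= expr0 mulr1 expr1.
  rewrite n0 expr0 mulr1 p1 expr1 mulrA ler_pdivlMr ?mulr_gt0//.
  have : A * r ^+ 2 >= gamma * t%:R * r ^+ 2 by rewrite ler_wpM2r ?sqr_ge0.
  have : 0 <= S * (gamma * t%:R) by rewrite !mulr_ge0 ?(ltW S_gt0) ?(ltW gamma0).
  lra.
have nR : 0 < (n%:R : R) by rewrite ltr0n.
have rho0 : 0 < rho by rewrite sqrtr_gt0 divr_gt0// ltr0n.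
have tau0 : 0 < tau by rewrite sqrtr_gt0 invr_gt0.
have b00 : 0 < b0 by rewrite !mulr_gt0.
have b02 : b0 ^+ 2 = n%:R / p.+1%:R * r ^+ 2 / t%:R.
  by rewrite /b0 !exprMn tau2 sqr_sqrtr// divr_ge0.
have bn0 : 0 < b0 ^+ n by rewrite exprn_gt0.
have hA : gamma ^+ p / b0 ^+ n * ((1 + n%:R / 2) * t%:R - n%:R / 2 / b0 ^+ 2 * S) <= A.
  have -> : (1 + n%:R / 2) * t%:R - n%:R / 2 / b0 ^+ 2 * S =
      \sum_(1 <= i < t.+1) (1 + n%:R / 2 * (1 - (a i * g i / b0) ^+ 2)).
    rewrite -sum_cst /S mulr_sumr -sumrB; apply: eq_bigr => i _.
    by rewrite expr_div_n; ring.
  rewrite mulr_sumr; apply: ler_sum_nat => i it.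
  have bi : 0 < a i * g i by rewrite mulr_gt0 ?a0 ?g0.
  have bin : 0 < (a i * g i) ^+ n by rewrite exprn_gt0.
  rewrite -(ler_pM2r bin).
  apply: (@le_trans _ _ (gamma ^+ p)); last by have := stepsize_ge it; rewrite {2}pE.
  have := expn_tangent n (divr_gt0 bi b00); rewrite [X in X * _]expr_div_n => h.
  rewrite -[leRHS]mulr1.
  have gp : 0 <= gamma ^+ p by rewrite exprn_ge0// ltW.
  apply: le_trans (ler_wpM2l gp h).
  by rewrite le_eqVlt; apply/orP; left; apply/eqP; ring.
have C0 : 0 <= r ^+ 2 * b0 ^+ n / (p.+1%:R * gamma ^+ p * t%:R).
  by rewrite divr_ge0// !mulr_ge0 ?exprn_ge0 ?(ltW gamma0) ?(ltW b00).
(* With this value of [b0 ^+ 2] the affine bound vanishes at [S = r ^+ 2], and the two sides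
   coincide. *)
apply: le_trans (ler_wpM2r C0 hA); rewrite b02.
rewrite le_eqVlt; apply/orP; left; apply/eqP.
have -> : p.+1%:R = n%:R + 2 :> R by rewrite pE -addn2 natrD.
by field; rewrite !gt_eqF ?exprn_gt0// addr_gt0.
Qed.

End Rates.

(** * Strong convexity and quadratic growth at a minimizer *)

Section StrongConvexity.
Context {R : realType} {E : vectType R} {B : 'Hom(E, dual E)}.
Hypotheses (Bs : self_adjoint B) (Bp : positive_definite B).
Local Notation N := (pnorm B).
Variable (D : set E).
Hypothesis (Dc : segment_convex D).

Definition strongly_convex_on (g : E -> R) : Prop := forall x y (s : R),
  D x -> D y -> 0 <= s <= 1 ->
  g (x + s *: (y - x)) <=
    (1 - s) * g x + s * g y - 2^-1 * (s * (1 - s)) * N (y - x) ^+ 2.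

Lemma strongly_convex_sqr c : strongly_convex_on (fun y => 2^-1 * N (y - c) ^+ 2).
Proof.
move=> x y s _ _ _; have -> : x + s *: (y - x) - c = (x - c) + s *: (y - x).
  by rewrite addrAC.
have -> : y - x = (y - c) - (x - c) by rewrite opprB addrA subrK.
move: (x - c) (y - c) => u z.
rewrite !(sqr_pnorm Bp) !innerE (innerC Bs z u) le_eqVlt; apply/orP; left.
by apply/eqP; ring.
Qed.

Lemma strongly_convexD g h : strongly_convex_on g -> segment_convex_on D h ->
  strongly_convex_on (fun y => g y + h y).
Proof.
by move=> hg hh x y s Dx Dy s01; have := hg x y s Dx Dy s01;
  have := hh x y s Dx Dy s01; lra.
Qed.

Lemma segment_convex_affine (G : 'Hom(E, R^o)) c (b : R) :
  segment_convex_on D (fun y => b * (G (y - c) : R)).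
Proof.
move=> x y s _ _ _; have -> : x + s *: (y - x) - c = (x - c) + s *: (y - x).
  by rewrite addrAC.
have -> : y - x = (y - c) - (x - c) by rewrite opprB addrA subrK.
move: (x - c) (y - c) => u z.
have -> : (G (u + s *: (z - u)) : R) = (G u : R) + s * ((G z : R) - (G u : R)).
  by rewrite linearD linearZ linearB.
by rewrite le_eqVlt; apply/orP; left; apply/eqP; ring.
Qed.

(** Minimality against [v + s *: (y - v)], divided by [s], leaves the quadratic term with factor
    [1 - s], which tends to 1. *)
Lemma strongly_convex_argmin g v y : strongly_convex_on g -> is_argmin D g v -> D y ->
  g v + 2^-1 * N (y - v) ^+ 2 <= g y.
Proof.
move=> gc [Dv vmin] Dy.
pose phi s := g y - g v - 2^-1 * N (y - v) ^+ 2 + s * (2^-1 * N (y - v) ^+ 2).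
suff : 0 <= phi 0 by rewrite /phi; lra.
apply: (ge0_right_limit ltr01).
  apply: cvgD; first exact: cvg_cst.
  by apply: cvgM; [exact: cvg_id | exact: cvg_cst].
move=> s /andP[s0 s1]; have s01 : 0 <= s <= 1 by rewrite !ltW.
have := gc v y s Dv Dy s01; have := vmin _ (Dc Dv Dy s01).
rewrite -(pmulr_rge0 _ s0) /phi; move: (g _) (g v) (g y) (N _ ^+ 2) => g1 g2 g3 n2.
lra.
Qed.

End StrongConvexity.

(** * The two methods *)

Section Methods.
Context {R : realType} {E : vectType R} {B : 'Hom(E, dual E)}.
Hypotheses (Bs : self_adjoint B) (Bp : positive_definite B).
Local Notation N := (pnorm B).
Variables (psi : E -> \bar R) (f : E -> R) (p : nat).
Variables (Df : forall i, E -> mform E i) (L M : R).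
Local Notation D := (effdom psi).
Local Notation F := (objective f psi).
Hypotheses (Dc : segment_convex D) (psic : segment_convex_on D (fun x => fine (psi x))).
Hypotheses (p0 : (0 < p)%N) (fc : segment_convex_on D f) (hf : Cp_on B D p f Df).
Hypotheses (L0 : 0 < L) (fL : mform_lipschitz_on B D (Df p) L) (LM : p%:R * L <= M).
Variables (x0 : E) (t : nat) (x v : nat -> E) (a : nat -> R).
Local Notation V i := (reduced_gradient B Df p M (v i.-1) (x i)).
Hypothesis (V0 : forall i, (1 <= i <= t)%N -> V i != 0).
Hypothesis (Dx0 : D x0).

Let V0S i : (i < t)%N -> V i.+1 != 0.
Proof. by move=> it; exact: V0. Qed.

(** Half the square of the norm of [h + b *: riesz G]. *)
Lemma quadratic_lower_bound (G : 'Hom(E, R^o)) h (b : R) :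
  0 <= 2^-1 * N h ^+ 2 + b * (G h : R) + 2^-1 * (b ^+ 2 * dnorm B G ^+ 2).
Proof.
have := sqr_ge0 (N (h + b *: riesz (B := B) G)).
rewrite (dnormE Bp) (rieszE Bp) !(sqr_pnorm Bp) !innerE (innerC Bs h).
by move=> hh; lra.
Qed.

(** What the two methods share; the points [v i] must lie in the domain because the data on
    derivatives hold only there. *)
Definition tensor_steps : Prop := forall i, (i < t)%N ->
  [/\ D (v i), is_tensor_step B psi Df p M (v i) (x i.+1) &
      a i.+1 = stepsize B Df p M (v i) (x i.+1)].

Lemma tensor_steps_gt0 i : tensor_steps -> (0 < i < t.+1)%N -> 0 < a i.
Proof.
case: i => // i gs it; have [Dv hT ->] := gs i it.
by apply: (stepsize_gt0 Bs Bp Dc p0 hf L0 fL LM Dv hT); exact: V0S.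
Qed.

(** The stepsize is chosen so that moving the base point from [x i.+1] to [v i] costs exactly
    [a i.+1 ^+ 2] times the squared dual norm. *)
Lemma tensor_step_shift i y : tensor_steps -> (i < t)%N ->
  a i.+1 * (V i.+1 (y - v i) : R) =
  a i.+1 * (V i.+1 (y - x i.+1) : R) - a i.+1 ^+ 2 * dnorm B (V i.+1) ^+ 2.
Proof.
move=> gs it; have [Dv hT aE] := gs i it.
have := stepsizeE Bp (V0S it); rewrite -aE /= => h.
have -> : y - v i = (y - x i.+1) - (v i - x i.+1) by rewrite opprB addrA subrK.
move: h; set G := reduced_gradient _ _ _ _ _ _.
have -> : (G (y - x i.+1 - (v i - x i.+1)) : R) =
  (G (y - x i.+1) : R) - (G (v i - x i.+1) : R) by rewrite linearB.
by move=> <-; ring.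
Qed.

Definition energy_bound y : Prop :=
  \sum_(1 <= i < t.+1) a i * (F (x i) - F y)
  + 2^-1 * (\sum_(1 <= i < t.+1) (a i * dnorm B (V i)) ^+ 2)
  <= 2^-1 * N (x0 - y) ^+ 2.

Lemma primal_tensor_steps : primal_method B psi Df p M x0 t x v a -> tensor_steps.
Proof.
move=> [_ v00 hm] i it; have [hT aE _] := hm i it; split=> //.
case: i it {hT aE} => [|i] it; first by rewrite v00.
by have [_ _ []] := hm i (ltnW it).
Qed.

Lemma primal_energy y : primal_method B psi Df p M x0 t x v a -> D y ->
  energy_bound y.
Proof.
move=> pm Dy; have gs := primal_tensor_steps pm; have [_ v00 hm] := pm.
(* The induction carries the remaining distance from [v s] to [y], which is discarded at the end. *)
suff H s : (s <= t)%N -> \sum_(1 <= i < s.+1) a i * (F (x i) - F y)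
    + 2^-1 * (\sum_(1 <= i < s.+1) (a i * dnorm B (V i)) ^+ 2)
    + 2^-1 * N (y - v s) ^+ 2 <= 2^-1 * N (x0 - y) ^+ 2.
  have := H t (leqnn t); rewrite /energy_bound.
  have := sqr_ge0 (N (y - v t)); lra.
elim: s => [|s IH] st.
  by rewrite !big_geq// v00 mulr0 !add0r (pnormB Bp).
have {}IH := IH (ltnW st); have [Dv hT aE] := gs s st.
have [_ _ hv] := hm s st.
have as0 : 0 < a s.+1 by apply: tensor_steps_gt0.
rewrite !(@big_nat_recr _ _ _ s.+1)//=.
set G := reduced_gradient B Df p M (v s) (x s.+1) in hv *.
have sc : strongly_convex_on (B := B) D
    (fun y => a s.+1 * (G (y - v s) : R) + 2^-1 * N (y - v s) ^+ 2).
  have := strongly_convexD (strongly_convex_sqr Bs Bp (D := D) (v s))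
    (segment_convex_affine (D := D) G (v s) (a s.+1)).
  by under [X in strongly_convex_on _ X]eq_fun do rewrite addrC.
have h1 := strongly_convex_argmin Dc sc hv Dy.
(* The auxiliary minimum is at least minus half of the square term released by [tensor_step_shift];
   the other half stays in the energy. *)
have h2 := quadratic_lower_bound G (v s.+1 - v s) (a s.+1).
have h3 := tensor_step_shift y gs st; rewrite /= -/G in h3.
have h4 : F (x s.+1) + (G (y - x s.+1) : R) <= F y.
  exact: (objective_subgradient Bs Bp Dc psic p0 fc hf L0 LM Dv hT Dy).
have h5 := ler_wpM2l (ltW as0) h4.
rewrite mulrDr in h5; rewrite exprMn; move: h1 h2 h3 h5 IH.
move: (F y) (F (x s.+1)) (\sum_(1 <= i < s.+1) a i * _) => Fy Fx S1.
move: (a s.+1 ^+ 2 * _) (a s.+1 * (G _ : R)) (a s.+1 * (G _ : R)).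
move: (a s.+1 * (G _ : R)) => q1 q2 q3 q4.
lra.
Qed.

Lemma dual_tensor_steps : dual_method B psi Df p M x0 t x v a -> tensor_steps.
Proof. by move=> [_ hm] i it; have [[Dv _] hT aE] := hm i it. Qed.

(** An estimate sequence: the model at [y] is bounded below by the accumulated terms ([H]) and above
    through the gradient inequality for [f] ([U]). *)
Lemma dual_energy y : dual_method B psi Df p M x0 t x v a -> D y ->
  energy_bound y.
Proof.
move=> dm Dy; have gs := dual_tensor_steps dm; have [_ hm] := dm.
pose Psi := dual_model B psi Df x0 x a.
have agt0 s : (s < t)%N -> 0 < a s.+1 by move=> st; apply: tensor_steps_gt0.
have sc s : (s <= t)%N -> strongly_convex_on (B := B) D (Psi s).
  elim: s => [|s IH] st; first exact: strongly_convex_sqr.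
  apply: strongly_convexD; first exact: IH (ltnW st).
  move=> z1 z2 c Dz1 Dz2 c01.
  have := segment_convex_affine (Df 1 (x s.+1)) (x s.+1) (a s.+1) Dz1 Dz2 c01.
  have := ler_wpM2l (ltW (agt0 s st)) (psic Dz1 Dz2 c01).
  rewrite !mulrDr; lra.
(* Stated for every [z], because the induction hypothesis is applied at the minimizer [v s] of the
   model. *)
have H s z : (s <= t)%N -> D z -> \sum_(1 <= i < s.+1) a i * fine (psi (x i))
    + 2^-1 * (\sum_(1 <= i < s.+1) (a i * dnorm B (V i)) ^+ 2) <= Psi s z.
  elim: s z => [|s IH] z st Dz.
    by rewrite !big_geq// mulr0 addr0 /Psi/= mulr_ge0// sqr_ge0.
  have [Dv hT aE] := gs s st; have [vmin _ _] := hm s st.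
  have h1 := strongly_convex_argmin Dc (sc s (ltnW st)) vmin Dz.
  have h0 := IH _ (ltnW st) Dv.
  rewrite !(@big_nat_recr _ _ _ s.+1)//= /Psi /= -/(Psi s z).
  set G := reduced_gradient B Df p M (v s) (x s.+1).
  have h2 := quadratic_lower_bound G (z - v s) (a s.+1).
  have h3 := tensor_step_shift z gs st; rewrite /= -/G in h3.
  have h4 : fine (psi (x s.+1)) + ((G (z - x s.+1) : R) -
      ((Df 1 (x s.+1) : 'Hom(E, R^o)) (z - x s.+1) : R)) <= fine (psi z).
    exact: (tensor_step_optimality Bs Bp Dc psic p0 hf L0 LM Dv hT Dz).
  have h5 := ler_wpM2l (ltW (agt0 s st)) h4.
  rewrite exprMn; move: h0 h1 h2 h3 h5; rewrite /Psi !mulrDr !mulrN.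
  move: (a s.+1 ^+ 2 * _) (a s.+1 * (G _ : R)) (a s.+1 * (G _ : R)) => q1 q2 q3.
  lra.
have U s : (s <= t)%N -> Psi s y <= 2^-1 * N (y - x0) ^+ 2 +
    \sum_(1 <= i < s.+1) a i * (f y - f (x i) + fine (psi y)).
  elim: s => [|s IH] st; first by rewrite big_geq// addr0.
  rewrite !(@big_nat_recr _ _ _ s.+1)//= /Psi /= -/(Psi s y) addrA.
  apply: lerD; first exact: IH (ltnW st).
  rewrite ler_pM2l ?agt0// lerD2r lerBrDl.
  have [Dv hT aE] := gs s st.
  exact: (gradient_ineq Bp Dc hf p0 fc (tensor_step_dom hT) Dy).
have h1 := H t y (leqnn t) Dy; have h2 := U t (leqnn t).
have E1 : \sum_(1 <= i < t.+1) a i * (F (x i) - F y) =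
    \sum_(1 <= i < t.+1) a i * fine (psi (x i))
    - \sum_(1 <= i < t.+1) a i * (f y - f (x i) + fine (psi y)).
  by rewrite -sumrB; apply: eq_bigr => i _; rewrite /objective; ring.
rewrite /energy_bound E1 (pnormB Bp); move: h1 h2; lra.
Qed.

End Methods.

(** For [M = p * L] and [p >= 2] the quotient inside [gamma_rate] is exactly [L ^+ 2], so the p-th
    power of the last factor is [L ^+ p.-1]; for [p = 1] both are 1. *)
Lemma gamma_rate_min (R : realType) p (L : R) : (0 < p)%N -> 0 < L ->
  (gamma_rate p L (p%:R * L))^-1 ^+ p = p.+1%:R * L / p`!%:R.
Proof.
move=> p0 L0; have pR : 0 < (p%:R : R) by rewrite ltr0n.
have F0 : 0 < (p`!%:R : R) by rewrite ltr0n fact_gt0.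
have p1R : 0 < (p.+1%:R : R) by rewrite ltr0n.
suff E : gamma_rate p L (p%:R * L) ^+ p = p`!%:R / p.+1%:R / L.
  by rewrite exprVn E; field; rewrite !gt_eqF//= addrC natr1.
have mE : ((p`!%:R / p.+1%:R) `^ p%:R^-1) ^+ p = p`!%:R / p.+1%:R :> R.
  by rewrite -powR_mulrn ?powR_ge0// -powRrM mulVf ?gt_eqF// powRr1.
have cE : p%:R / (p%:R * L) = L^-1 by field; rewrite !gt_eqF.
rewrite /gamma_rate cE; set K := (X in _ * X).
suff KE : K ^+ p = L ^+ p.-1.
  rewrite !exprMn mE KE exprVn -[in X in X^-1](prednK p0) exprS.
  by field; rewrite !gt_eqF ?exprn_gt0//= addrC natr1.
rewrite /K; case: eqP => [->|/eqP p1]; first by rewrite expr1n.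
have Q0 : (p%:R ^+ 2 - 1 : R) != 0.
  by rewrite subr_eq0 gt_eqF// expr_gt1// ltr1n ltn_neqAle eq_sym p1.
have -> : ((p%:R * L) ^+ 2 - L ^+ 2) / (p%:R ^+ 2 - 1) = L ^+ 2 by field.
rewrite -powR_mulrn ?powR_ge0// -powRrM.
have -> : (p%:R - 1) / (2 * p%:R) * p%:R = p.-1%:R / 2 :> R.
  have -> : p.-1%:R = p%:R - 1 :> R by rewrite -[in RHS](prednK p0) -natr1 addrK.
  by field; rewrite gt_eqF.
by rewrite powR_half ?sqr_ge0// sqrtr_sqr ger0_norm// ltW.
Qed.


(* Note that 0 `^ 0 = 1. *)
Theorem mainTheorem3 (R : realType) (E : vectType R) (B : 'Hom(E, dual E))
    (psi : E -> \bar R) (f : E -> R) (p : nat)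
    (Df : forall i : nat, E -> mform E i) (Lp M : R) (xstar x0 : E)
    (x v : nat -> E) (a : nat -> R) (t : nat) :
  self_adjoint B -> positive_definite B ->
  proper_function psi -> closed_convex B psi ->
  (1 <= p)%N ->
  convex_function (effdom psi) f ->
  Cp_on B (effdom psi) p f Df ->
  0 < Lp -> mform_lipschitz_on B (effdom psi) (Df p) Lp ->
  is_argmin (effdom psi) (objective f psi) xstar ->
  p%:R * Lp <= M ->
  effdom psi x0 ->
  primal_method B psi Df p M x0 t x v a \/ dual_method B psi Df p M x0 t x v a ->
  let V := fun i : nat => reduced_gradient B Df p M (v i.-1) (x i) in
  (forall i : nat, (1 <= i <= t)%N -> V i != 0) ->
  (1 <= t)%N ->
  let r := pnorm B (x0 - xstar) in
  let g := \big[Num.min/dnorm B (V 1%N)]_(1 <= i < t.+1) dnorm B (V i) in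
  let A := \sum_(1 <= i < t.+1) a i in
  let Ftilde := A^-1 * \sum_(1 <= i < t.+1) a i * objective f psi (x i) in
  let Fstar := objective f psi xstar in
  [/\ g <= ((gamma_rate p Lp M)^-1 * r) ^+ p * (t%:R^-1) `^ (p%:R / 2),
      Ftilde - Fstar <=
        r ^+ p.+1 / p.+1%:R * (gamma_rate p Lp M)^-1 ^+ p
        * ((p%:R - 1) / p.+1%:R) `^ ((p%:R - 1) / 2)
        * (t%:R^-1) `^ (p.+1%:R / 2) &
      M = p%:R * Lp ->
        g <= p.+1%:R * Lp / p`!%:R * r ^+ p * (t%:R^-1) `^ (p%:R / 2) /\
        Ftilde - Fstar <=
          Lp * r ^+ p.+1 / p`!%:R
          * ((p%:R - 1) / p.+1%:R) `^ ((p%:R - 1) / 2)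
          * (t%:R^-1) `^ (p.+1%:R / 2)].

Proof.
move=> Bs Bp psip psiC p0 fconv hf L0 fL [Dxs xmin] LM Dx0 hmeth V V0 t0 r g A Ftilde Fstar.
have Dc := segment_convex_effdom psip psiC.
have psic := segment_convex_fine psip psiC.
have fc := segment_convex_function fconv.
have [gs EB] : tensor_steps (B := B) psi p Df M t x v a /\
    energy_bound (B := B) psi f p Df M x0 t x v a xstar.
  case: hmeth => h; split.
  - exact: primal_tensor_steps h.
  - exact: (primal_energy Bs Bp Dc psic p0 fc hf L0 fL LM V0 Dx0 h Dxs).
  - exact: dual_tensor_steps h.
  - exact: (dual_energy Bs Bp Dc psic p0 fc hf L0 fL LM V0 h Dxs).
have a0 i : (0 < i < t.+1)%N -> 0 < a i.
  exact: (tensor_steps_gt0 Bs Bp Dc p0 hf L0 fL LM V0 gs).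
have Vn i : (0 < i < t.+1)%N -> 0 < dnorm B (V i).
  by move=> it; apply: (dnorm_gt0 Bp); exact: V0.
(* The real p-th root, so that the exponent [(p + 1) / p] becomes an integral power of [w i]. *)
pose w i := dnorm B (V i) `^ p%:R^-1.
have w0 i : (0 < i < t.+1)%N -> 0 < w i by move=> it; rewrite powR_gt0// Vn.
have wE i : (0 < i < t.+1)%N -> w i ^+ p = dnorm B (V i).
  move=> it; rewrite -powR_mulrn ?powR_ge0// -powRrM mulVf ?powRr1 ?dnorm_ge0//.
  by rewrite pnatr_eq0 -lt0n.
have ha i : (0 < i < t.+1)%N ->
    gamma_rate p Lp M * w i ^+ p.+1 <= a i * dnorm B (V i) ^+ 2.
  move=> it; have wi0 := w0 i it; have wiE := wE i it; have Vi := V0 i it.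
  case: i it wi0 wiE Vi => // i it wi0 wiE Vi; have [Dv hT ->] := gs i it.
  rewrite (stepsizeE Bp Vi).
  exact: (reduced_gradient_descent Bs Bp Dc p0 hf L0 fL LM Dv hT wi0 wiE).
have d0 i : (0 < i < t.+1)%N -> 0 <= objective f psi (x i) - Fstar.
  case: i => // i it; have [_ hT _] := gs i it; rewrite subr_ge0.
  exact: xmin _ (tensor_step_dom hT).
have gam0 := gamma_rate_gt0 p0 L0 LM.
have r0 : 0 <= r by exact: pnorm_ge0.
have A0 : 0 < A.
  rewrite /A big_ltn ?ltnS// ltr_pwDl//; first by rewrite a0// ltnS t0.
  by rewrite big_nat_cond; apply: sumr_ge0 => i /andP[/andP[i1 it] _];
    rewrite ltW// a0// it (ltnW i1).
have H1 : g <= ((gamma_rate p Lp M)^-1 * r) ^+ p * t%:R^-1 `^ (p%:R / 2).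
  (* It remains that [g] is nonnegative, default value included, and at most each of the norms. *)
  apply: (min_gradient_rate p0 t0 gam0 r0 a0 w0 wE ha d0 EB).
    by apply: le_bigmin => [|i _]; exact: dnorm_ge0.
  by move=> i it; apply: ge_bigmin_seq => //; rewrite mem_index_iota.
have H2 := averaged_rate p0 t0 gam0 r0 a0 w0 wE ha d0 EB.
have {}H2 : Ftilde - Fstar <=
    r ^+ p.+1 / p.+1%:R * (gamma_rate p Lp M)^-1 ^+ p
    * ((p%:R - 1) / p.+1%:R) `^ ((p%:R - 1) / 2) * t%:R^-1 `^ (p.+1%:R / 2).
  rewrite -(ler_pM2l A0); apply: le_trans H2.
  rewrite mulrBr /Ftilde mulrA mulfV ?gt_eqF// mul1r /A mulr_suml -sumrB.
  by apply: ler_sum => i _; rewrite mulrBr.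
split=> // ME; have GE := gamma_rate_min p0 L0; rewrite -ME in GE.
split.
  by move: H1; rewrite exprMn GE.
move: H2; rewrite GE => /le_trans; apply; rewrite le_eqVlt; apply/orP; left; apply/eqP.
congr (_ * _ * _); field.
by rewrite pnatr_eq0 -lt0n fact_gt0/= addrC natr1 pnatr_eq0.
Qed.
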